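(* Let $d\ge1$, $n\ge2$, $k\ge1$, $\mu_1,\dots,\mu_k\in\mathbb{R}^d$, let $\Sigma_1,\dots,\Sigma_k$ be $d\times d$ positive definite matrices, and let $w_1,\dots,w_k\ge0$ with $\sum_jw_j=1$. Let $$h^*(x):=\sum_{j=1}^kw_j\,\phi_d(x;\mu_j,\Sigma_j),\qquad x\in\mathbb{R}^d,$$ and let $\sigma_{\min}^2,\sigma_{\max}^2$ be positive numbers with $$\sigma_{\min}^2\le\min_{1\le j\le k}\lambda_{\min}(\Sigma_j)\le\max_{1\le j\le k}\lambda_{\max}(\Sigma_j)\le\sigma_{\max}^2.$$ Let $Y_1,\dots,Y_n$ be independent and identically distributed observations having density $h^*$. Let $\hat f_n$ be any NPMLE based on $X_1:=Y_1/\sigma_{\min},\dots,X_n:=Y_n/\sigma_{\min}$, and define $$\hat h_n(x):=\sigma_{\min}^{-d}\hat f_n(\sigma_{\min}^{-1}x),\qquad x\in\mathbb{R}^d.$$ Then, for a positive constant $C_d$ depending only on $d$, $$\mathbb{E}\,\mathfrak{H}^2(\hat h_n,h^* )\le C_d\left(\frac kn\right)\left(\max(1,\tau)\right)^d(\log n)^{d+1},\qquad\text{where }\tau:=\sqrt{\frac{\sigma_{\max}^2}{\sigma_{\min}^2}-1}.$$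
   Context: $\phi_d(\cdot;\mu,\Sigma)$ denotes the $d$-variate normal density with mean $\mu$ and covariance matrix $\Sigma$, and $\lambda_{\min},\lambda_{\max}$ denote smallest and largest eigenvalues. $\phi_d(z):=(2\pi)^{-d/2}\exp(-\|z\|^2/2)$; for a probability measure $G$ on $\mathbb{R}^d$, $f_G(x):=\int\phi_d(x-\theta)\,dG(\theta)$, and $\mathcal{M}$ is the class of all $f_G$ as $G$ ranges over all probability measures on $\mathbb{R}^d$. An NPMLE based on $X_1,\dots,X_n$ is any maximizer $\hat f_n\in\arg\max_{f\in\mathcal{M}}\frac1n\sum_{i=1}^n\log f(X_i)$. $\mathfrak{H}^2(f,g):=\int(\sqrt{f(x)}-\sqrt{g(x)})^2dx$ is the squared Hellinger distance. *)

(* Defs.v *)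
From HB Require Import structures.
From mathcomp Require Import all_boot all_order all_algebra.
From mathcomp Require Import all_classical all_reals all_analysis.

Set Implicit Arguments.
Unset Strict Implicit.
Unset Printing Implicit Defensive.

Import Order.TTheory GRing.Theory Num.Theory.
Import numFieldNormedType.Exports.

Local Open Scope classical_set_scope.
Local Open Scope ring_scope.

(* Row vectors carry the product sigma-algebra generated by the coordinates,   *)
(* as n.-tuple T does in the library. For T = R this is the Borel              *)
(* sigma-algebra of R^n.                                                       *)
Definition measure_rV_display : measure_display -> measure_display.
Proof. exact. Qed.

Section measurable_rV.
Context {d} {T : sigmaRingType d}.
Variable n : nat.

Let coors : 'I_n -> 'rV[T]_n -> T := fun i x => x ord0 i.

Let rV_set0 : g_sigma_preimage coors set0.
Proof. exact: sigma_algebra0. Qed.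

Let rV_setC A : g_sigma_preimage coors A -> g_sigma_preimage coors (~` A).
Proof. exact: sigma_algebraC. Qed.

Let rV_bigcup (F : _^nat) : (forall i, g_sigma_preimage coors (F i)) ->
  g_sigma_preimage coors (\bigcup_i (F i)).
Proof. exact: sigma_algebra_bigcup. Qed.

HB.instance Definition _ := @isMeasurable.Build (measure_rV_display d)
  'rV[T]_n (g_sigma_preimage coors) rV_set0 rV_setC rV_bigcup.

End measurable_rV.


Lemma measurable_rV_coord d (T : sigmaRingType d) n (i : 'I_n) :
  measurable_fun [set: 'rV[T]_n] (fun x => x ord0 i).
Proof.
move=> _ Y mY; rewrite setTI; apply: sub_sigma_algebra => /=.
rewrite -bigcup_seq/=; exists i => /=; first by rewrite mem_index_enum.
by exists Y => //; rewrite setTI.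
Qed.

Lemma measurable_fun_rVP d1 d2 (T1 : measurableType d1)
    (T2 : measurableType d2) n (f : T1 -> 'rV[T2]_n) :
  measurable_fun [set: T1] f <->
  forall i, measurable_fun [set: T1] (fun x => f x ord0 i).
Proof.
split=> [mf i|mf _ A].
  by apply: (measurableT_comp (measurable_rV_coord i)) mf.
rewrite setTI /measurable/= => mA.
suff sub : g_sigma_preimage (fun (i : 'I_n) (x : 'rV[T2]_n) => x ord0 i) `<=`
    [set B | measurable (f @^-1` B)] by exact: sub.
apply: smallest_sub.
  split => [|B mB|F mF] /=.
  - by rewrite preimage_set0.
  - by rewrite setTD preimage_setC; exact: measurableC.
  - by rewrite preimage_bigcup; apply: bigcup_measurable => k _; exact: mF.
rewrite -bigcup_seq/= => B [i _ [C mC <-]].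
rewrite /= setTI -comp_preimage -[X in measurable X]setTI.
exact: mf.
Qed.

Section lebesgue_rV.
Variable R : realType.
Local Open Scope ereal_scope.

Definition rV_cons n (p : measurableTypeR R * 'rV[R]_n) : 'rV[R]_n.+1 :=
  row_mx (const_mx p.1 : 'rV[R]_1) p.2.

Lemma rV_cons0 n p : @rV_cons n p ord0 ord0 = p.1.
Proof. by rewrite mxE; case: splitP => // j _; rewrite mxE. Qed.

Lemma rV_consS n p (i : 'I_n) : rV_cons p ord0 (lift ord0 i) = p.2 ord0 i.
Proof.
rewrite mxE; case: splitP => [[[]]//|j]; rewrite lift0 => -[ij].
by congr (_ _ _); exact/val_inj.
Qed.

Lemma measurable_rV_cons n : measurable_fun setT (@rV_cons n).
Proof.
apply/measurable_fun_rVP => i; case: (unliftP ord0 i) => [j ->|->].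
  under eq_fun do rewrite rV_consS.
  exact: (measurableT_comp (measurable_rV_coord j) measurable_snd).
by under eq_fun do rewrite rV_cons0; exact: measurable_fst.
Qed.

Definition rV_uncons n (x : 'rV[R]_n.+1) : measurableTypeR R * 'rV[R]_n :=
  (x ord0 ord0, \row_i x ord0 (lift ord0 i)).

Lemma rV_consK n : cancel (@rV_cons n) (@rV_uncons n).
Proof.
move=> [a x]; rewrite /rV_uncons rV_cons0; congr pair.
by apply/rowP => i; rewrite mxE rV_consS.
Qed.

Lemma measurable_rV_uncons n : measurable_fun setT (@rV_uncons n).
Proof.
apply/measurable_fun_pairP; split; first exact: measurable_rV_coord.
apply/measurable_fun_rVP => i.
rewrite [X in measurable_fun _ X](_ : _ =
    (fun x : 'rV[R]_n.+1 => x ord0 (lift ord0 i))).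
  exact: measurable_rV_coord.
by apply/funext => x /=; rewrite mxE.
Qed.

Section succ.
Context n (m : {sigma_finite_measure set 'rV[R]_n -> \bar R}).

Definition lebesgue_rV_succ : set 'rV[R]_n.+1 -> \bar R :=
  pushforward (lebesgue_measure \x m) (@rV_cons n).

Let succ0 : lebesgue_rV_succ set0 = 0.
Proof. by rewrite /lebesgue_rV_succ /pushforward preimage_set0 measure0. Qed.

Let succ_ge0 A : 0 <= lebesgue_rV_succ A.
Proof. by rewrite /lebesgue_rV_succ /pushforward; apply: measure_ge0. Qed.

Let succ_sigma_additive : semi_sigma_additive lebesgue_rV_succ.
Proof.
by have := @measure_semi_sigma_additive _ _ _
  (pushforward (lebesgue_measure \x m) (@rV_cons n)); apply;
  exact: measurable_rV_cons.
Qed.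

HB.instance Definition _ := isMeasure.Build _ _ _ lebesgue_rV_succ
  succ0 succ_ge0 succ_sigma_additive.

Let succ_sigma_finite : sigma_finite setT lebesgue_rV_succ.
Proof.
have /sigma_finiteP[F [TF ndF Foo]] := sigma_finiteT (@lebesgue_measure R).
have /sigma_finiteP[G [TG ndG Goo]] := sigma_finiteT m.
exists (fun k => @rV_uncons n @^-1` (F k `*` G k)) => [|k].
  rewrite -preimage_bigcup (_ : \bigcup_k _ = setT) ?preimage_setT//.
  apply/seteqP; split => // -[x y] _.
  have [i _ Fi] : (\bigcup_k F k) x by rewrite -TF.
  have [j _ Gj] : (\bigcup_k G k) y by rewrite -TG.
  exists (maxn i j) => //; split => /=.
  - by move: Fi; apply/subsetPset/ndF; rewrite leq_maxl.
  - by move: Gj; apply/subsetPset/ndG; rewrite leq_maxr.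
have [mF Fk] := Foo k; have [mG Gk] := Goo k; split.
  rewrite -[X in measurable X]setTI.
  by apply: measurable_rV_uncons => //; exact: measurableX.
rewrite /lebesgue_rV_succ /pushforward/= -comp_preimage.
rewrite (_ : @rV_uncons n \o _ = id); last first.
  by apply/funext => p /=; rewrite rV_consK.
rewrite preimage_id product_measure1E// lte_mul_pinfty// ge0_fin_numE//.
Qed.

HB.instance Definition _ := Measure_isSigmaFinite.Build _ _ _ lebesgue_rV_succ
  succ_sigma_finite.

End succ.

(* Lebesgue measure on R^n, on its Borel sets: the n-fold product of the       *)
(* library's one-dimensional Lebesgue measure, carried to row vectors (see     *)
(* lebesgue_rV_box).                                                           *)
Fixpoint lebesgue_rV n : {sigma_finite_measure set 'rV[R]_n -> \bar R} :=
  match n with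
  | 0%N => \d_(0%R : 'rV[R]_0)
  | n'.+1 => lebesgue_rV_succ (lebesgue_rV n')
  end.

Lemma measurable_rV_box n (A : 'I_n -> set R) :
  (forall i, measurable (A i)) ->
  measurable [set x : 'rV[R]_n | forall i, A i (x ord0 i)].
Proof.
move=> mA.
rewrite (_ : [set _ | _] = \bigcap_(i in [set: 'I_n])
    ((fun x : 'rV[R]_n => x ord0 i) @^-1` A i)); last first.
  by apply/seteqP; split => x /= Ax i => [_|]; exact: Ax.
apply: fin_bigcap_measurable; first exact: finite_finset.
by move=> i _; rewrite -[X in measurable X]setTI; exact: measurable_rV_coord.
Qed.

Lemma lebesgue_rV_box n (A : 'I_n -> set R) : (forall i, measurable (A i)) ->
  lebesgue_rV n [set x | forall i, A i (x ord0 i)] =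
  \prod_(i < n) lebesgue_measure (A i).
Proof.
elim: n A => [|n IH] A mA.
  by rewrite big_ord0 /= diracE mem_set// => -[].
rewrite big_ord_recl -(IH (fun i => A (lift ord0 i)))//=.
have mB := measurable_rV_box (fun i => mA (lift ord0 i)).
rewrite -(product_measure1E lebesgue_measure (lebesgue_rV n) (mA ord0) mB).
rewrite /lebesgue_rV_succ /pushforward; congr (product_measure1 _ _ _).
apply/seteqP; split => [p /= Ap|p /= [A0 Ap] i].
  split; first by rewrite -(rV_cons0 p); exact: Ap.
  by move=> i; rewrite -rV_consS; exact: Ap.
by case: (unliftP ord0 i) => [j ->|->]; rewrite ?rV_consS ?rV_cons0//; exact: Ap.
Qed.

End lebesgue_rV.

Section positive_definite.
Variables (R : realType) (d : nat).
Implicit Types A : 'M[R]_d.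

Definition posdefmx A : Prop :=
  A^T = A /\ forall x : 'rV[R]_d, x != 0 -> 0 < (x *m A *m x^T) ord0 ord0.

(* For a symmetric matrix and 0 < d the set of eigenvalues is finite and       *)
(* nonempty, so these are its smallest and largest elements.                   *)
Definition lambda_min A : R := inf [set a | eigenvalue A a].
Definition lambda_max A : R := sup [set a | eigenvalue A a].

End positive_definite.

Section gaussian_mixtures.
Variables (R : realType) (d : nat).
Implicit Types (f g h : 'rV[R]_d -> R) (x z theta : 'rV[R]_d).

(* The squared Euclidean norm; the library norm on 'rV[R]_d is the sup norm. *)
Definition sqnorm2 z : R := \sum_(i < d) z ord0 i ^+ 2.

Definition std_normal_density z : R :=
  (2 * pi) `^ (- (d%:R / 2)) * expR (- (sqnorm2 z / 2)).

Definition normal_density (mu : 'rV[R]_d) (Sigma : 'M[R]_d) x : R :=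
  (2 * pi) `^ (- (d%:R / 2)) * \det Sigma `^ (- 2^-1) *
  expR (- (((x - mu) *m invmx Sigma *m (x - mu)^T) ord0 ord0 / 2)).

Definition finite_normal_mixture k (w : 'I_k -> R) (mu : 'I_k -> 'rV[R]_d)
    (Sigma : 'I_k -> 'M[R]_d) x : R :=
  \sum_(j < k) w j * normal_density (mu j) (Sigma j) x.

Definition location_mixture (G : probability 'rV[R]_d R) x : R :=
  \int[G]_theta std_normal_density (x - theta).

Definition location_mixtures : set ('rV[R]_d -> R) :=
  [set f | exists G : probability 'rV[R]_d R, f = location_mixture G].

Definition mean_loglik n (X : 'I_n -> 'rV[R]_d) f : R :=
  n%:R^-1 * \sum_(i < n) ln (f (X i)).

(* Elements of location_mixtures are positive everywhere, so ln is never       *)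
(* evaluated outside its domain here.                                          *)
Definition is_npmle n (X : 'I_n -> 'rV[R]_d) f : Prop :=
  location_mixtures f /\
  forall g, location_mixtures g -> mean_loglik X g <= mean_loglik X f.

Definition sq_hellinger f g : \bar R :=
  (\int[lebesgue_rV R d]_x ((Num.sqrt (f x) - Num.sqrt (g x)) ^+ 2)%:E)%E.

End gaussian_mixtures.

Section random_vectors.
Context dO (Omega : measurableType dO) (R : realType)
  (P : probability Omega R).

Definition has_density d (Y : {RV P >-> 'rV[R]_d}) (h : 'rV[R]_d -> R) : Prop :=
  forall A, measurable A ->
    distribution P Y A = (\int[lebesgue_rV R d]_(x in A) (h x)%:E)%E.

Definition mutually_independent dT (T : measurableType dT) n
    (Y : 'I_n -> {RV P >-> T}) : Prop :=
  forall (J : {set 'I_n}) (A : 'I_n -> set T), (forall i, measurable (A i)) ->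
    P (\bigcap_(i in [set` J]) (Y i @^-1` A i)) =
    (\prod_(i in J) P (Y i @^-1` A i))%E.

End random_vectors.

(* Main.v *)
From HB Require Import structures.
Require Import Defs.
From mathcomp Require Import all_boot all_order all_algebra.
From mathcomp Require Import all_classical all_reals all_analysis.
From mathcomp Require Import measurable_realfun ring lra.
From mathcomp Require spectral sesquilinear complex polyrcf.

Import Order.TTheory GRing.Theory Num.Theory.
Import numFieldNormedType.Exports.

Local Open Scope classical_set_scope.
Local Open Scope ring_scope.

Set Implicit Arguments.
Unset Strict Implicit.
Unset Printing Implicit Defensive.

(** Why the theorem holds.

    Put s = sigma_min.  Every Sigma_j dominates s^2 I, so each component of
    hstar is a Gaussian smoothing with covariance s^2 I of another Gaussian law;
    hence hstar itself belongs to the class of rescaled location mixtures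
    y |-> s^-d f_G(y / s) over which the rescaled NPMLE maximises the
    likelihood ([scaled_location_mixture_gaussian],
    [scaled_location_mixture_convex]).  The estimate is therefore at least as
    likely as the truth on the sample.

    One may assume k max(1, tau)^d <= n, as otherwise the claimed bound exceeds
    the largest possible loss ([trivial_rate_ge2]).

    The class is small on bounded sets.  The one-dimensional kernel
    exp(-(x-t)^2/2) equals the series with terms g_a(x) g_a(t), where
    g_a(x) = x^a exp(-x^2/2) / sqrt(a!) and |g_a| <= 1; truncating it at m of
    order log n costs a negative power of n, uniformly in t, as long as |x| is
    at most sqrt(log n) ([truncated_kernel_error]).  On a cube of half-side
    s sqrt(log n) every mixture is then given, up to that error, by the m^d
    moments of G against products of the g_a, which all lie in [-1, 1].
    Rounding these moments to a grid of polynomially many values brackets the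
    class on the cube by finitely many functions, with log-cardinality of order
    (log n)^{d+1} ([mixture_bracketed]).  A union of boxes of half-side of
    order sigma_max sqrt(log n) around the k means carries hstar up to a mass
    O(1/n^2) ([gaussian_mixture_tail]), and is cut into at most
    k (6 max(1, tau))^d such cubes.  The side sqrt(log n) of the cubes is what
    keeps further logarithms out of this count.

    Finally, let u_j be the upper brackets, S the union of the cubes and
    rho_j the integral over S of sqrt(u_j hstar).  If the whole sample lies in S
    and u_j brackets the estimate, the product Z_j of the ratios
    sqrt(u_j / hstar) over the sample is at least 1, whereas by independence its
    expectation is rho_j^n <= exp(-n (1 - rho_j)).  So the average over the N
    brackets of Z_j exp(n (1 - rho_j)) has expectation at most 1 and dominates
    exp(n (1 - rho_j)) / N for the j that brackets the estimate; by y <= e^y it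
    dominates n (1 - rho_j) - log N as well.  As the squared Hellinger distance
    is at most 2 (1 - rho_j) plus a term of the order of the bracket width
    ([hellinger_bracket]), and at most 2 on the unlikely event that the sample
    leaves S, its expectation is at most (2/n) log N + O(1/n)
    ([bracketing_hellinger_bound]).  The loss is thus
    dominated pointwise by a measurable function of the sample, which bounds
    the integral of the loss for every selection of maximisers
    ([le_lower_integral]). *)

(** * Integrals of nonnegative functions *)

Section measure_transfer.
Import HBNNSimple.
Local Open Scope ereal_scope.

(** The integral of a nonnegative function is the supremum of the integrals of
    the simple functions below it; hence it is monotone, also on the loss of an
    arbitrary selection of maximisers. *)
Lemma le_lower_integral d (T : measurableType d) (R : realType)
    (mu : {measure set T -> \bar R}) (f g : T -> \bar R) :
  (forall x, 0 <= f x <= g x) -> \int[mu]_x f x <= \int[mu]_x g x.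
Proof.
move=> fg; have f0 x : 0 <= f x by case/andP: (fg x).
have g0 x : 0 <= g x by apply: le_trans (f0 x) _; case/andP: (fg x).
rewrite !ge0_integralTE//; apply: ereal_sup_le => _ [h /= hf <-].
by exists h => //= x; rewrite (le_trans (hf x))//; case/andP: (fg x).
Qed.

(** An identity between measures of sets passes to nonnegative functions, by
    approximation with simple functions.  With X the identity and K a density
    it is integration against a density; with X one coordinate of an
    independent family and K a function of the others it is one step of the
    product rule for expectations. *)
Lemma ge0_integral_weighted_transfer d1 d2 (T1 : measurableType d1)
    (T2 : measurableType d2) (R : realType) (m1 : {measure set T1 -> \bar R})
    (m2 : {measure set T2 -> \bar R}) (X : T1 -> T2) (K : T1 -> R) (c : R) :
  measurable_fun setT X -> measurable_fun setT K ->
  (forall x, (0 <= K x)%R) -> (0 <= c)%R ->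
  (forall A, measurable A ->
     \int[m1]_(x in X @^-1` A) (K x)%:E = c%:E * m2 A) ->
  forall g : T2 -> \bar R, measurable_fun setT g -> (forall y, 0 <= g y) ->
  \int[m1]_x ((K x)%:E * g (X x)) = c%:E * \int[m2]_y g y.
Proof.
move=> mX mK K0 c0 H g mg g0.
pose f_ := nnsfun_approx measurableT mg.
have cvgf y : (EFin \o f_ n) y @[n --> \oo] --> g y.
  by apply: cvg_nnsfun_approx.
transitivity (limn (fun n => \int[m1]_x ((K x)%:E * (f_ n (X x))%:E))).
  rewrite -monotone_convergence//; last 3 first.
  - move=> n; apply: emeasurable_funM; first exact/measurable_EFinP.
    by apply/measurable_EFinP; exact: measurableT_comp.
  - by move=> n x _; rewrite mule_ge0// lee_fin.
  - move=> x _ a b ab; apply: lee_wpmul2l; first by rewrite lee_fin.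
    by rewrite lee_fin; exact/lefP/nd_nnsfun_approx.
  apply: eq_integral => x _; apply/esym/cvg_lim => //.
  by apply: cvgeZl => //; exact: cvgf.
transitivity (limn (fun n => \int[m2]_y (c%:E * (f_ n y)%:E))); last first.
  rewrite -monotone_convergence//; last 3 first.
  - move=> n; apply: emeasurable_funM; first exact: measurable_cst.
    exact/measurable_EFinP.
  - by move=> n x _; rewrite mule_ge0// lee_fin.
  - move=> x _ a b ab; apply: lee_wpmul2l; first by rewrite lee_fin.
    by rewrite lee_fin; exact/lefP/nd_nnsfun_approx.
  rewrite -ge0_integralZl//.
  apply: eq_integral => x _; apply/cvg_lim => //.
  by apply: cvgeZl => //; exact: cvgf.
congr (limn _); apply/funext => n.
have mpre r : measurable (f_ n @^-1` [set r]) by exact: measurable_sfunP.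
have mXpre r : measurable (X @^-1` (f_ n @^-1` [set r])).
  by rewrite -[X in measurable X]setTI; exact: mX.
have ind r (x : T1) : (\1_(f_ n @^-1` [set r]) (X x) : R) =
    \1_(X @^-1` (f_ n @^-1` [set r])) x by [].
transitivity (\sum_(r \in range (f_ n))
    \int[m1]_x ((K x)%:E * (r * \1_(X @^-1` (f_ n @^-1` [set r])) x)%:E)).
  rewrite -ge0_integral_fsum//; last 2 first.
  - move=> r; apply: emeasurable_funM; first exact/measurable_EFinP.
    by apply/measurable_EFinP; apply: measurable_funM.
  - move=> r x _; apply: mule_ge0; first by rewrite lee_fin.
    rewrite EFinM; exact: (nnfun_muleindic_ge0 (f_ n) r (X x)).
  apply: eq_integral => x _; rewrite [in LHS]fimfunE -fsumEFin// ge0_mule_fsumr//.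
  by move=> r; rewrite EFinM; exact: nnfun_muleindic_ge0.
have mfn : measurable_fun setT (fun y => (f_ n y)%:E) by exact/measurable_EFinP.
rewrite [in RHS]ge0_integralZl//; last by move=> y _; rewrite lee_fin.
rewrite integralT_nnsfun sintegralE ge0_mule_fsumr; last first.
  by move=> r; exact: nnsfun_mulemu_ge0.
apply: eq_fsbigr => r; rewrite inE => -[y _ ry].
have r0 : (0 <= r)%R by rewrite -ry.
transitivity (r%:E * \int[m1]_x ((K x)%:E * (\1_(X @^-1` (f_ n @^-1` [set r])) x)%:E)).
  rewrite -ge0_integralZl//; last 2 first.
  - apply: emeasurable_funM; first exact/measurable_EFinP.
    by apply/measurable_EFinP.
  - by move=> x _; rewrite mule_ge0// lee_fin.
  by apply: eq_integral => x _; rewrite EFinM muleCA.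
rewrite muleCA -H//; congr (_ * _).
rewrite [RHS]integral_mkcond; apply: eq_integral => x _.
by rewrite patchE indicE; case: ifPn => _; rewrite ?mule1 ?mule0.
Qed.

End measure_transfer.

Section product_integrals.
Local Open Scope ereal_scope.

Lemma ge0_integral_density d (T : measurableType d) (R : realType)
    (m1 m2 : {measure set T -> \bar R}) (h : T -> R) :
  measurable_fun setT h -> (forall x, (0 <= h x)%R) ->
  (forall A, measurable A -> m1 A = \int[m2]_(x in A) (h x)%:E) ->
  forall g : T -> \bar R, measurable_fun setT g -> (forall y, 0 <= g y) ->
  \int[m1]_x g x = \int[m2]_x ((h x)%:E * g x).
Proof.
move=> mh h0 H g mg g0.
rewrite (@ge0_integral_weighted_transfer _ _ _ _ _ m2 m1 id h 1%R)//.
  by rewrite mul1e.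
by move=> A mA; rewrite preimage_id mul1e H.
Qed.

(** Induction on the number m of slots that may hold arbitrary functions, the
    other slots holding indicators.  For m = 0 this is independence; the step
    transfers the identity, known when slot m holds an indicator, to a
    function in that slot. *)
Lemma expectation_prod_independent dO (Omega : measurableType dO)
    (R : realType) (P : probability Omega R) dT (T : measurableType dT) n
    (Y : 'I_n -> {RV P >-> T}) (g : 'I_n -> T -> R) (r : 'I_n -> R) :
  mutually_independent Y ->
  (forall i, measurable_fun setT (g i)) -> (forall i y, (0 <= g i y)%R) ->
  (forall i, \int[P]_w (g i (Y i w))%:E = (r i)%:E) ->
  \int[P]_w (\prod_(i < n) g i (Y i w))%:E = (\prod_(i < n) r i)%:E.
Proof.
move=> indep.
suff claim m : (m <= n)%N -> forall (f : 'I_n -> T -> R) (s : 'I_n -> R),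
    (forall i, measurable_fun setT (f i)) -> (forall i y, (0 <= f i y)%R) ->
    (forall i, \int[P]_w (f i (Y i w))%:E = (s i)%:E) ->
    (forall i : 'I_n, (m <= i)%N ->
       exists2 A, measurable A & f i = \1_A :> (T -> R)) ->
    \int[P]_w (\prod_(i < n) f i (Y i w))%:E = (\prod_(i < n) s i)%:E.
  move=> mg g0 rE; apply: (claim n) => // i.
  by rewrite leqNgt ltn_ord.
elim: m => [_ f s mf f0 sE /(_ _ (leq0n _)) ind|m IH mn f s mf f0 sE ind].
  have {}ind i : { A : set T | measurable A & f i = \1_A :> (T -> R) }.
    by apply/cid2/ind.
  pose A i := s2val (ind i).
  have mA i : measurable (A i) by exact: (s2valP (ind i)).
  have fA i : f i = \1_(A i) :> (T -> R) by exact: (s2valP' (ind i)).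
  have mYA i : measurable (Y i @^-1` A i).
    by rewrite -[X in measurable X]setTI; exact: measurable_funP.
  have [J JT] : exists J : {set 'I_n}, forall i, i \in J.
    by exists [set: 'I_n]%SET => i; rewrite finset.in_setT.
  transitivity (\int[P]_w (\1_(\bigcap_(i in [set` J]) (Y i @^-1` A i)) w : R)%:E).
    apply: eq_integral => w _; congr EFin.
    under eq_bigr do rewrite fA.
    have [h|/existsNP[i hi]] := pselect (forall i, A i (Y i w)).
      rewrite indicE mem_set; last by move=> i _; exact: h.
      by rewrite big1// => i _; rewrite indicE mem_set.
    rewrite (bigD1 i)//= indicE memNset// mul0r indicE memNset//.
    by move=> /(_ i) Ai; apply: hi; apply: Ai; exact: JT.
  rewrite integral_indic//; last first.
    by apply: fin_bigcap_measurable => // *; exact: finite_finset.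
  rewrite setIT; apply: (etrans (indep J A mA)); rewrite -prodEFin.
  apply: eq_big => [i|i _]; first by rewrite JT.
  rewrite -sE; under eq_integral do rewrite fA.
  by rewrite (_ : (fun _ => _) = EFin \o \1_(Y i @^-1` A i))// integral_indic// setIT.
(* The slot m is the one whose indicator is replaced by f_m. *)
pose i0 := Ordinal mn.
have s0 i : (0 <= s i)%R.
  by rewrite -lee_fin -sE; apply: integral_ge0 => w _; rewrite lee_fin.
rewrite (bigD1 i0)//= mulrC EFinM -(sE i0).
have := @ge0_integral_distribution _ _ _ _ _ P (Y i0) (fun y => (f i0 y)%:E).
move=> /(_ _ _)/= <-//; last 2 first.
- exact/measurable_EFinP.
- by move=> y; rewrite lee_fin.
pose K w := (\prod_(i < n) if i != i0 then f i (Y i w) else 1)%R.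
rewrite -(@ge0_integral_weighted_transfer _ _ _ _ _ P (distribution P (Y i0)) (Y i0) K)//; last first.
- by move=> y; rewrite lee_fin.
- exact/measurable_EFinP.
- move=> A mA.
  pose fA i := if i == i0 then \1_A else f i.
  pose sA i := if i == i0 then fine (P (Y i0 @^-1` A)) else s i.
  have mYA : measurable (Y i0 @^-1` A).
    by rewrite -[X in measurable X]setTI; exact: measurable_funP.
  have -> : (\prod_(i < n | i != i0) s i)%:E * distribution P (Y i0) A =
      (\prod_(i < n) sA i)%:E.
    rewrite [in RHS](bigD1 i0)//= {1}/sA eqxx mulrC EFinM fineK; last exact: fin_num_measure.
    by congr (_%:E * _); apply: eq_bigr => i /negbTE; rewrite /sA => ->.
  rewrite -(IH (ltnW mn) fA sA).
  - rewrite integral_mkcond; apply: eq_integral => w _.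
    rewrite (bigD1 i0)//= {1}/fA eqxx.
    rewrite (eq_bigr (fun i => f i (Y i w))); last by move=> i /negbTE; rewrite /fA => ->.
    rewrite patchE indicE /K -big_mkcond/=.
    have -> : (w \in Y i0 @^-1` A) = (Y i0 w \in A) by [].
    by case: ifPn => _; rewrite ?mul1r ?mul0r.
  - by move=> i; rewrite /fA; case: eqP.
  - by move=> i y; rewrite /fA; case: eqP.
  - move=> i; rewrite /fA /sA; case: eqP => [->|_]; last exact: sE.
    rewrite (_ : (fun _ => _) = EFin \o \1_(Y i0 @^-1` A))//.
    by rewrite integral_indic// setIT fineK//; exact: fin_num_measure.
  - move=> i; rewrite leq_eqVlt => /orP[/eqP mi|/ind [B mB fB]].
      by exists A => //; rewrite /fA (_ : i = i0) ?eqxx//; exact/val_inj.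
    rewrite /fA; case: eqP => _; first by exists A.
    by exists B.
- by apply: prodr_ge0.
- by move=> w; apply: prodr_ge0 => i _; case: ifP.
- apply: measurable_prod => i _; case: (i != i0) => //.
  by apply: measurableT_comp.
apply: eq_integral => w _.
rewrite /K -(big_mkcond (fun i => i != i0))/= -EFinM; congr EFin.
by rewrite [LHS](bigD1 i0)//= mulrC.
Qed.

Lemma integral_lebesgue_rV_prod (R : realType) n (f : 'I_n -> R -> R)
    (r : 'I_n -> R) :
  (forall i, measurable_fun setT (f i)) -> (forall i y, (0 <= f i y)%R) ->
  (forall i, \int[lebesgue_measure]_x (f i x)%:E = (r i)%:E) ->
  \int[lebesgue_rV R n]_x (\prod_(i < n) f i (x ord0 i))%:E =
  (\prod_(i < n) r i)%:E.
Proof.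
elim: n f r => [|n IH] f r mf f0 rE.
  rewrite big_ord0; under eq_integral do rewrite big_ord0.
  by rewrite [lebesgue_rV R 0]/= integral_dirac// diracT mul1e.
rewrite [lebesgue_rV R n.+1]/=.
have mF k (h : 'I_k -> R -> R) : (forall i, measurable_fun setT (h i)) ->
    measurable_fun [set: 'rV[R]_k] (fun x : 'rV[R]_k => (\prod_(i < k) h i (x ord0 i))%:E).
  move=> mh; apply/measurable_EFinP; apply: measurable_prod => i _.
  exact: (measurableT_comp (mh i) (measurable_rV_coord i)).
rewrite /lebesgue_rV_succ ge0_integral_pushforward//=; last 3 first.
- exact: measurable_rV_cons.
- exact: mF.
- by move=> x _; rewrite lee_fin; apply: prodr_ge0.
rewrite preimage_setT.
rewrite fubini_tonelli1//=; last 2 first.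
- by apply: (measurableT_comp (mF _ _ mf)); exact: measurable_rV_cons.
- by move=> x; rewrite lee_fin; apply: prodr_ge0.
rewrite /fubini_F/=.
transitivity (\int[lebesgue_measure]_x ((f ord0 x)%:E * (\prod_(i < n) r (lift ord0 i))%:E)).
  apply: eq_integral => x _.
  rewrite -(IH (fun i => f (lift ord0 i)))// -ge0_integralZl//; last 3 first.
  - by apply: (mF n (fun i => f (lift ord0 i))).
  - by move=> y _; rewrite lee_fin; apply: prodr_ge0.
  - by rewrite lee_fin.
  apply: eq_integral => y _; rewrite -EFinM big_ord_recl rV_cons0.
  by under eq_bigr do rewrite rV_consS.
rewrite ge0_integralZr//; last 3 first.
- by apply/measurable_EFinP; exact: (mf ord0).
- by move=> x _; rewrite lee_fin.
- rewrite lee_fin; apply: prodr_ge0 => i _.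
  by rewrite -lee_fin -rE; apply: integral_ge0 => w _; rewrite lee_fin.
by rewrite rE -EFinM big_ord_recl.
Qed.

End product_integrals.

(** * Eigenvalue bounds for real symmetric matrices *)

Module RealSymmetric.
Import sesquilinear spectral complex.

Section sum_of_squares.
Variables (R : realType) (d : nat).
Local Notation C := (complex R).
Local Notation toC := (map_mx (real_complex R)).

(** Over the complex numbers the spectral theorem gives
    B = sum_k l_k p_k^* p_k with l_k >= 0.  As B is real, it is the real part
    of this sum, and the real part of p^* p is
    (Re p)^T (Re p) + (Im p)^T (Im p). *)
Lemma psd_sum_rank1 (B : 'M[R]_d) :
  B^T = B -> (forall a, eigenvalue B a -> 0 <= a) ->
  exists s : seq 'rV[R]_d, B = \sum_(v <- s) v^T *m v.
Proof.
move=> symB eigB.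
set A := (toC B : 'M[C]_d).
have hA : A \is hermsymmx.
  apply/is_hermitianmxP; rewrite expr0 scale1r; apply/matrixP => i j; rewrite !mxE.
  by rewrite conj_Creal; [rewrite -[in LHS]symB mxE | apply/complex_realP; exists (B j i)].
have rD := hermitian_spectral_diag_real hA.
have /orthomx_spectralP AE := hermitian_normalmx hA.
set P := spectralmx A in AE; set D := spectral_diag A in AE rD.
have uP : P \is unitarymx := spectral_unitarymx A.
have Pu : P \in unitmx := spectral_unit A.
(* Row k of P is an eigenvector for D_k; a real eigenvalue over the complex
   numbers is a root of the same characteristic polynomial, hence an eigenvalue
   of B. *)
have lD k : exists l : R, D 0 k = real_complex R l /\ 0 <= l.
  have /mxOverP /(_ 0 k) /complex_realP [l Dl] := rD.
  exists l; split => //; apply: eigB.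
  rewrite eigenvalue_root_char -(fmorph_root (real_complex R)) map_char_poly.
  rewrite -eigenvalue_root_char; apply/eigenvalueP; exists (row k P).
    rewrite -row_mul -/A {1}AE !mulmxA mulmxV// mul1mx.
    by rewrite mul_diag_mx; apply/rowP => j; rewrite !mxE Dl.
  apply/negP => /eqP rk0; have := congr1 (mulmx^~ (invmx P)) rk0.
  rewrite -row_mul mulmxV// mul0mx => /rowP /(_ k); rewrite !mxE eqxx => /eqP.
  by rewrite oner_eq0.
have [l lP] := choice lD.
exists ([seq Num.sqrt (l k) *: (\row_j complex.Re (P k j)) | k <- index_enum (ordinal d)] ++
        [seq Num.sqrt (l k) *: (\row_j complex.Im (P k j)) | k <- index_enum (ordinal d)]).
apply/matrixP => i j.
have -> : B i j = complex.Re (A i j) by rewrite mxE.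
rewrite big_cat/= !big_map/=.
have -> : A i j = \sum_k complex.conjc (P k i) * real_complex R (l k) * P k j.
  have := congr1 (fun M : 'M[C]_d => M i j) AE; rewrite /= => ->.
  rewrite invmx_unitary// -mulmxA mul_diag_mx mxE; apply: eq_bigr => k _.
  rewrite !mxE (lP k).1 mulrA; congr (_ * _ * _).
rewrite [RHS]mxE !summxE -big_split/= (raddf_sum (@complex.Re R : {additive _ -> _})).
apply: eq_bigr => k _; rewrite !mxE !big_ord1 !mxE.
case: (P k i) => a b; case: (P k j) => a' b' /=.
have sq : Num.sqrt (l k) * Num.sqrt (l k) = l k by rewrite -expr2 sqr_sqrtr// (lP k).2.
by move: sq; move: (Num.sqrt (l k)) => u; move: (l k) => lk <-; ring.
Qed.

End sum_of_squares.
End RealSymmetric.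

Section eigenvalue_bounds.
Variables (R : realType) (d : nat).
Implicit Types (S : 'M[R]_d) (x y : 'rV[R]_d).

Lemma sqnorm2E x : (x *m x^T) 0 0 = sqnorm2 x.
Proof. by rewrite mxE; apply: eq_bigr => i _; rewrite mxE expr2. Qed.

Lemma sqnorm2_ge0 x : 0 <= sqnorm2 x.
Proof. by apply: sumr_ge0 => i _; exact: sqr_ge0. Qed.

Lemma sqnorm2_gt0 x : x != 0 -> 0 < sqnorm2 x.
Proof.
move=> x0; rewrite lt_neqAle sqnorm2_ge0 andbT eq_sym; apply: contra x0.
rewrite /sqnorm2 psumr_eq0; last by move=> i _; exact: sqr_ge0.
move=> /allP h; apply/eqP/rowP => i; rewrite mxE.
by have := h i (mem_index_enum _); rewrite sqrf_eq0 => /eqP.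
Qed.

Lemma eigenvalue_posdef_gt0 S a : posdefmx S -> eigenvalue S a -> 0 < a.
Proof.
move=> [_ pS] /eigenvalueP [v vS v0]; have := pS v v0.
by rewrite vS -scalemxAl mxE sqnorm2E pmulr_lgt0// sqnorm2_gt0.
Qed.

Lemma has_lbound_eigenvalues S : posdefmx S -> has_lbound [set a | eigenvalue S a].
Proof. by move=> pS; exists 0 => a /= /(eigenvalue_posdef_gt0 pS)/ltW. Qed.

Lemma has_ubound_eigenvalues S : has_ubound [set a | eigenvalue S a].
Proof.
exists (polyrcf.cauchy_bound (char_poly S)) => a /=.
rewrite eigenvalue_root_char => /rootP r0.
have p0 : char_poly S != 0 by rewrite monic_neq0// char_poly_monic.
by apply: le_trans (ltW (polyrcf.cauchy_boundP p0 r0)); exact: ler_norm.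
Qed.

(** Gaussian laws are handled below one rank-one update at a time, which only
    involves one-dimensional integrals. *)
Lemma lambda_min_sum_rank1 S (c : R) : posdefmx S -> c <= lambda_min S ->
  exists s : seq 'rV[R]_d, S = c%:M + \sum_(v <- s) v^T *m v.
Proof.
move=> pS cS; have [|a /eigenvalueP[v vS v0]|s sE] := @RealSymmetric.psd_sum_rank1 R d (S - c%:M).
- by rewrite linearB/= tr_scalar_mx pS.1.
- rewrite -(lerD2r c) add0r; apply: (le_trans cS); apply: inf_lbound.
    exact: has_lbound_eigenvalues.
  apply/eigenvalueP; exists v => //.
  by rewrite scalerDl -vS mulmxBr mul_mx_scalar subrK.
- by exists s; rewrite -sE addrC subrK.
Qed.

(** The matrix c I - S has nonnegative eigenvalues, hence is a sum of squares. *)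
Lemma lambda_max_quadratic S (c : R) : posdefmx S -> lambda_max S <= c ->
  forall x, (x *m S *m x^T) 0 0 <= c * sqnorm2 x.
Proof.
move=> pS cS x; have [|a /eigenvalueP[v vS v0]|s sE] := @RealSymmetric.psd_sum_rank1 R d (c%:M - S).
- by rewrite linearB/= tr_scalar_mx pS.1.
- have eS : eigenvalue S (c - a).
    apply/eigenvalueP; exists v => //.
    by rewrite scalerBl -vS mulmxBr mul_mx_scalar opprB addrC subrK.
  suff : c - a <= c by rewrite gerDl oppr_le0.
  apply: le_trans cS; apply: sup_ubound => //.
  exact: has_ubound_eigenvalues.
- have -> : S = c%:M - \sum_(v <- s) v^T *m v by rewrite -sE opprB addrC subrK.
  rewrite mulmxBr mulmxBl mul_mx_scalar -scalemxAl mxE [X in X + _]mxE sqnorm2E.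
  rewrite gerDl [X in X <= _]mxE oppr_le0 mulmx_sumr mulmx_suml summxE.
  apply: sumr_ge0 => v _; 
  have -> : x *m (v^T *m v) *m x^T = (x *m v^T) *m (x *m v^T)^T.
    by rewrite trmx_mul trmxK !mulmxA.
  by rewrite mxE; apply: sumr_ge0 => i _; rewrite [X in _ * X]mxE -expr2 sqr_ge0.
Qed.
End eigenvalue_bounds.

Section rank_one_update.
Variables (R : realType) (d : nat).
Implicit Types (S : 'M[R]_d) (x y v : 'rV[R]_d).

Lemma posdef_unitmx S : posdefmx S -> S \in unitmx.
Proof.
move=> [_ pS]; rewrite -row_free_unit -kermx_eq0; apply/eqP/row_matrixP => i.
rewrite row0; apply/eqP; apply: contraT => r0; have := pS _ r0.
by rewrite -row_mul mulmx_ker row0 mul0mx mxE ltxx.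
Qed.

Lemma posdef_trmx_inv S : posdefmx S -> (invmx S)^T = invmx S.
Proof. by move=> [sS _]; rewrite trmx_inv sS. Qed.

Lemma posdef_inv_quadratic_ge0 S x : posdefmx S ->
  0 <= (x *m invmx S *m x^T) 0 0.
Proof.
move=> pS; have uS := posdef_unitmx pS.
have -> : x *m invmx S *m x^T = (x *m invmx S) *m S *m (x *m invmx S)^T.
  by rewrite trmx_mul posdef_trmx_inv// !mulmxA mulmxKV.
have [->|y0] := eqVneq (x *m invmx S) 0; first by rewrite mul0mx trmx0 mulmx0 mxE.
exact/ltW/pS.2.
Qed.

(** Expand the nonnegative number y S y^T at y = x / c - x S^-1. *)
Lemma inv_quadratic_lower_bound S (c : R) : posdefmx S -> 0 < c ->
  (forall x, (x *m S *m x^T) 0 0 <= c * sqnorm2 x) ->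
  forall x, sqnorm2 x / c <= (x *m invmx S *m x^T) 0 0.
Proof.
move=> pS c0 Sc x; have uS := posdef_unitmx pS.
pose y := c^-1 *: x - x *m invmx S.
have : 0 <= (y *m S *m y^T) 0 0.
  have [->|y0] := eqVneq y 0; first by rewrite mul0mx trmx0 mulmx0 mxE.
  exact/ltW/pS.2.
have yS : y *m S = c^-1 *: (x *m S) - x by rewrite mulmxBl -scalemxAl mulmxKV.
have yT : y^T = c^-1 *: x^T - invmx S *m x^T.
  by rewrite linearB/= linearZ/= trmx_mul posdef_trmx_inv.
have e : x *m S *m (invmx S *m x^T) = x *m x^T by rewrite -mulmxA mulKVmx.
rewrite yS yT mulmxBl !mulmxBr -!scalemxAl -!scalemxAr e mulmxA.
have := Sc x; rewrite -(sqnorm2E x).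
move: (x *m S *m x^T) (x *m x^T) (x *m invmx S *m x^T) => q t p qc.
rewrite !mxE => y0.
have : c^-1 * (c^-1 * q 0 0) <= c^-1 * t 0 0.
  by rewrite ler_pM2l ?invr_gt0// ler_pdivrMl.
by rewrite mulrC; lra.
Qed.

Variables (S : 'M[R]_d) (v : 'rV[R]_d).
Hypothesis pS : posdefmx S.
Let a := (v *m invmx S *m v^T) 0 0.

Lemma posdef_rank1_update : posdefmx (S + v^T *m v).
Proof.
split; first by rewrite linearD/= trmx_mul trmxK pS.1.
move=> x x0; rewrite mulmxDr mulmxDl mxE.
apply: ltr_pwDl; first exact: pS.2.
have -> : x *m (v^T *m v) *m x^T = (x *m v^T) *m (x *m v^T)^T.
  by rewrite trmx_mul trmxK !mulmxA.
by rewrite mxE; apply: sumr_ge0 => i _; rewrite [X in _ * X]mxE -expr2 sqr_ge0.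
Qed.

(** After factoring out S, the two triangular factorisations of the same
    bordered matrix identify det (1 + u v) with 1 + v u. *)
Lemma det_rank1_update : \det (S + v^T *m v) = \det S * (1 + a).
Proof.
have uS := posdef_unitmx pS.
have -> : S + v^T *m v = S *m (1%:M + (invmx S *m v^T) *m v).
  by rewrite mulmxDr mulmx1 !mulmxA mulmxV// mul1mx.
rewrite det_mulmx; congr (_ * _).
set u := invmx S *m v^T.
have : block_mx (1%:M : 'M[R]_1) 0 u 1%:M *m block_mx 1%:M (- v) 0 (1%:M + u *m v) =
       block_mx (1%:M + v *m u) (- v) 0 1%:M *m block_mx 1%:M 0 u 1%:M.
  rewrite !mulmx_block !mul1mx !mulmx1 !mulmx0 !mul0mx !addr0 !add0r mulmxN mulNmx.
  by congr block_mx; rewrite ?addrK// addrC addrK.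
move=> /(congr1 determinant); rewrite !det_mulmx !det_ublock !det_lblock !det1 !mul1r !mulr1.
move=> ->; rewrite det_mx11 mxE mxE eqxx; congr (_ + _).
by rewrite /a /u mulmxA.
Qed.

(** The quadratic form of the Sherman-Morrison formula. *)
Lemma inv_rank1_update_quadratic x :
  (x *m invmx (S + v^T *m v) *m x^T) 0 0 =
  (x *m invmx S *m x^T) 0 0 - (x *m invmx S *m v^T) 0 0 ^+ 2 / (1 + a).
Proof.
have uS := posdef_unitmx pS.
have a0 : 0 <= a by exact: posdef_inv_quadratic_ge0.
have a1 : 1 + a != 0 by rewrite gt_eqF// ltr_pwDl.
have vSv : v *m invmx S *m v^T = a%:M by rewrite [LHS]mx11_scalar.
have -> : invmx (S + v^T *m v) =
    invmx S - (1 + a)^-1 *: (invmx S *m v^T *m (v *m invmx S)).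
  have uT := posdef_unitmx posdef_rank1_update.
  apply: (can_inj (mulKmx uT)); rewrite mulmxV//.
  have e1 : (S + v^T *m v) *m invmx S = 1%:M + v^T *m (v *m invmx S).
    by rewrite mulmxDl mulmxV// mulmxA.
  have e2 : (S + v^T *m v) *m (invmx S *m v^T *m (v *m invmx S)) =
      (1 + a) *: (v^T *m (v *m invmx S)).
    rewrite mulmxDl -(mulmxA (invmx S)) mulKVmx// scalerDl scale1r; congr (_ + _).
    have -> : v^T *m v *m (invmx S *m (v^T *m (v *m invmx S))) =
        v^T *m ((v *m invmx S *m v^T) *m (v *m invmx S)) by rewrite !mulmxA.
    by rewrite vSv mul_scalar_mx -scalemxAr.
  by rewrite mulmxBr -scalemxAr e1 e2 scalerA mulVf// scale1r addrK.
rewrite mulmxBr mulmxBl mxE [X in _ + X]mxE; congr (_ - _).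
rewrite -scalemxAr -scalemxAl mxE mulrC; congr (_ * _).
have -> : x *m (invmx S *m v^T *m (v *m invmx S)) *m x^T =
  (x *m invmx S *m v^T) *m (x *m invmx S *m v^T)^T.
  by rewrite !trmx_mul trmxK posdef_trmx_inv// !mulmxA.
by rewrite mxE big_ord1 [X in _ * X]mxE expr2.
Qed.

End rank_one_update.

(** * Gaussian location mixtures *)

Section location_mixture_theory.
Variables (R : realType) (d : nat).
Local Notation V := 'rV[R]_d.
Implicit Types (x y z theta mu : V) (G : probability V R).

Lemma measurable_sqnorm2_comp dT (T : measurableType dT) (f : T -> V) :
  measurable_fun setT f -> measurable_fun setT (fun t => sqnorm2 (f t)).
Proof.
move=> /measurable_fun_rVP mf; rewrite /sqnorm2.
by apply: measurable_sum => i; apply: measurable_funX; exact: mf.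
Qed.

Lemma measurable_rV_sub dT (T : measurableType dT) (f g : T -> V) :
  measurable_fun setT f -> measurable_fun setT g ->
  measurable_fun setT (fun t => f t - g t).
Proof.
move=> /measurable_fun_rVP mf /measurable_fun_rVP mg.
apply/measurable_fun_rVP => i; under eq_fun do rewrite !mxE.
by apply: measurable_funB; [exact: mf|exact: mg].
Qed.

Lemma measurable_rV_scale dT (T : measurableType dT) (a : T -> R) (f : T -> V) :
  measurable_fun setT a -> measurable_fun setT f ->
  measurable_fun setT (fun t => a t *: f t).
Proof.
move=> ma /measurable_fun_rVP mf.
apply/measurable_fun_rVP => i; under eq_fun do rewrite !mxE.
by apply: measurable_funM => //; exact: mf.
Qed.

Lemma measurable_std_normal_density_comp dT (T : measurableType dT) (f : T -> V) :
  measurable_fun setT f -> measurable_fun setT (fun t => std_normal_density (f t)).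
Proof.
move=> mf; apply: measurable_funM => //; apply: measurableT_comp => //.
apply: measurableT_comp => //; apply: measurable_funM => //.
exact: measurable_sqnorm2_comp.
Qed.

Lemma std_normal_density_gt0 z : 0 < std_normal_density z.
Proof. by rewrite mulr_gt0 ?expR_gt0// powR_gt0// mulr_gt0// pi_gt0. Qed.

Lemma std_normal_density_le z :
  std_normal_density z <= (2 * pi) `^ (- (d%:R / 2)).
Proof.
rewrite ler_piMr ?powR_ge0// -[leRHS]expR0 ler_expR oppr_le0.
by rewrite divr_ge0// sqnorm2_ge0.
Qed.

Lemma measurable_std_normal_density_shift x :
  measurable_fun setT (fun theta : V => std_normal_density (x - theta)).
Proof.
by apply: measurable_std_normal_density_comp; apply: measurable_rV_sub.
Qed.

Lemma location_mixtureE G x : (location_mixture G x)%:E =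
  (\int[G]_theta (std_normal_density (x - theta))%:E)%E.
Proof.
rewrite /location_mixture /Rintegral fineK// ge0_fin_numE; last first.
  by apply: integral_ge0 => t _; rewrite lee_fin ltW// std_normal_density_gt0.
apply: (@le_lt_trans _ _ (\int[G]_theta ((2 * pi) `^ (- (d%:R / 2)))%:E)%E).
  apply: ge0_le_integral => //=.
  - by move=> t _; rewrite lee_fin ltW// std_normal_density_gt0.
  - by apply/measurable_EFinP; exact: measurable_std_normal_density_shift.
  - by move=> t _; rewrite lee_fin std_normal_density_le.
by rewrite integral_cst// [X in (_ * X)%E]probability_setT mule1 ltry.
Qed.

(** Positivity makes the logarithm of a mixture meaningful at every point; it
    holds because a positive function has a positive integral against a
    probability. *)
Lemma location_mixture_gt0 G x : 0 < location_mixture G x.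
Proof.
have f0 (t : V) : (0%R <= (std_normal_density (x - t))%:E)%E.
  by rewrite lee_fin ltW// std_normal_density_gt0.
have mf : measurable_fun setT (fun t : V => (std_normal_density (x - t))%:E).
  by apply/measurable_EFinP; exact: measurable_std_normal_density_shift.
rewrite -lte_fin location_mixtureE lt_neqAle integral_ge0 ?andbT//.
apply/eqP => /esym i0.
have : (\int[G]_t `|(std_normal_density (x - t))%:E| = 0)%E.
  by under eq_integral do rewrite gee0_abs//.
move/(ae_eq_integral_abs G measurableT mf) => [N [mN GN subN]].
have NT : N = setT.
  apply/seteqP; split => // t _; apply: subN => /= /(_ I) [] /eqP.
  by rewrite gt_eqF// std_normal_density_gt0.
have := probability_setT G; rewrite -NT => G1.
have : (1 = 0 :> \bar R)%E by rewrite -G1 -GN.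
by move=> /eqP; rewrite onee_eq0.
Qed.

Lemma measurable_location_mixture G : measurable_fun setT (location_mixture G).
Proof.
apply/measurable_EFinP.
rewrite (_ : _ \o _ = fubini_F G (fun p : V * V => (std_normal_density (p.1 - p.2))%:E)).
  apply: measurable_fun_fubini_tonelli_F.
    apply/measurable_EFinP/measurable_std_normal_density_comp.
    exact: measurable_rV_sub.
  by move=> p; rewrite lee_fin ltW// std_normal_density_gt0.
by apply/funext => x /=; rewrite location_mixtureE.
Qed.

(** Isotropic Gaussian densities are products of one-dimensional ones, so their
    integrals reduce to the one-dimensional normal law. *)
Lemma prod_normal_pdf (s : R) (mu y : V) : 0 < s ->
  \prod_(i < d) normal_pdf (mu ord0 i) s (y ord0 i) =
  s ^- d * (2 * pi) `^ (- (d%:R / 2)) * expR (- (sqnorm2 (y - mu) / (s ^+ 2 * 2))).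
Proof.
move=> s0; rewrite (eq_bigr (fun i => s^-1 * (2 * pi) `^ (- 2^-1) *
    expR (- ((y - mu) ord0 i ^+ 2 / (s ^+ 2 * 2))))); last first.
  move=> i _; rewrite normal_pdfE ?gt_eqF// /normal_peak /normal_fun.
  rewrite -mulr_natr mulNr !mxE mulr_natr; congr (_ * _).
    rewrite -mulrnAr -[pi *+ 2]mulr_natl sqrtrM ?sqr_ge0// sqrtr_sqr gtr0_norm//.
    by rewrite invfM -[Num.sqrt (2 * pi)]powR12_sqrt ?powRN// mulr_ge0// pi_ge0.
  by rewrite mulr_natr.
rewrite big_split/= prodr_const card_ord exprMn exprVn; congr (_ * _ * _).
  rewrite -powR_mulrn ?powR_ge0// -powRrM; congr powR; lra.
rewrite -expR_sum; congr expR.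
by rewrite sumrN /sqnorm2 mulr_suml.
Qed.

Lemma integral_gaussian_rV (s : R) (mu : V) : 0 < s ->
  (\int[lebesgue_rV R d]_y (s ^- d * (2 * pi) `^ (- (d%:R / 2)) *
      expR (- (sqnorm2 (y - mu) / (s ^+ 2 * 2))))%:E = 1)%E.
Proof.
move=> s0; under eq_integral do rewrite -prod_normal_pdf//.
rewrite (@integral_lebesgue_rV_prod _ _ (fun i => normal_pdf (mu ord0 i) s) (fun=> 1)).
- by rewrite prodr_const expr1n.
- by move=> i; exact: measurable_normal_pdf.
- by move=> i y; exact: normal_pdf_ge0.
- by move=> i; exact: integral_normal_pdf.
Qed.

Lemma scaled_std_normal_density (s : R) y theta : 0 < s ->
  s ^- d * std_normal_density (s^-1 *: y - theta) =
  s ^- d * (2 * pi) `^ (- (d%:R / 2)) *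
      expR (- (sqnorm2 (y - s *: theta) / (s ^+ 2 * 2))).
Proof.
move=> s0; rewrite /std_normal_density mulrA; congr (_ * expR (- _)).
rewrite /sqnorm2 !mulr_suml; apply: eq_bigr => i _; rewrite !mxE.
field; exact: lt0r_neq0.
Qed.

Lemma integral_scaled_location_mixture (s : R) G : 0 < s ->
  (\int[lebesgue_rV R d]_y (s ^- d * location_mixture G (s^-1 *: y))%:E = 1)%E.
Proof.
move=> s0; have sd0 : (0 <= (s ^- d)%:E)%E by rewrite lee_fin invr_ge0 exprn_ge0// ltW.
pose F (p : V * V) := (s ^- d * std_normal_density (s^-1 *: p.1 - p.2))%:E.
have mF : measurable_fun setT F.
  apply/measurable_EFinP; apply: measurable_funM => //.
  apply: measurable_std_normal_density_comp; apply: measurable_rV_sub => //.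
  exact: measurable_rV_scale.
have F0 p : (0 <= F p)%E.
  by rewrite lee_fin mulr_ge0// ltW// std_normal_density_gt0.
transitivity (\int[lebesgue_rV R d]_y \int[G]_theta F (y, theta))%E.
  apply: eq_integral => y _; rewrite EFinM location_mixtureE -ge0_integralZl//.
    by apply/measurable_EFinP; exact: measurable_std_normal_density_shift.
  by move=> t _; rewrite lee_fin ltW// std_normal_density_gt0.
rewrite (fubini_tonelli F)//.
transitivity (\int[G]_theta (1%:E))%E.
  apply: eq_integral => t _; rewrite /F/=.
  by under eq_integral do rewrite scaled_std_normal_density//; exact: integral_gaussian_rV.
by rewrite integral_cst// [X in (_ * X)%E]probability_setT mule1.
Qed.

End location_mixture_theory.

Section gaussian_convolution.
Variables (R : realType) (d : nat).
Local Notation V := 'rV[R]_d.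

Lemma measurable_normal_density_comp dT (T : measurableType dT) (mu : V)
    (S : 'M[R]_d) (f : T -> V) :
  measurable_fun setT f -> measurable_fun setT (fun t => normal_density mu S (f t)).
Proof.
move=> mf; apply: measurable_funM => //; apply: measurableT_comp => //.
apply: measurableT_comp => //; apply: measurable_funM => //.
under eq_fun do rewrite mxE.
apply: measurable_sum => i; apply: measurable_funM; last first.
  under eq_fun do rewrite mxE.
  by move: i; apply/measurable_fun_rVP; exact: measurable_rV_sub.
under eq_fun do rewrite mxE.
apply: measurable_sum => j; apply: measurable_funM => //.
by move: j; apply/measurable_fun_rVP; exact: measurable_rV_sub.
Qed.

Lemma normal_density_ge0 (mu : V) (S : 'M[R]_d) x : 0 <= normal_density mu S x.
Proof. by rewrite !mulr_ge0 ?powR_ge0 ?expR_ge0. Qed.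

(** Gaussian convolution in the direction v: completing the square in t
    leaves the density with covariance S + v^T v times a one-dimensional
    normal density in t, whose integral is 1. *)
Lemma normal_density_rank1_convolution (mu v x : V) (S : 'M[R]_d) :
  posdefmx S -> 0 < \det S ->
  (\int[normal_prob 0 1]_t (normal_density mu S (x - t *: v))%:E =
   (normal_density mu (S + v^T *m v) x)%:E)%E.
Proof.
move=> pS dS; set a := (v *m invmx S *m v^T) 0 0.
have a0 : 0 <= a by exact: posdef_inv_quadratic_ge0.
have a1 : 0 < 1 + a by rewrite ltr_pwDl.
have [z zE] : exists z, z = x - mu by exists (x - mu).
pose b := (z *m invmx S *m v^T) 0 0.
pose m := b / (1 + a); pose sg := (Num.sqrt (1 + a))^-1.
have sg0 : 0 < sg by rewrite invr_gt0 sqrtr_gt0.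
have expand t : ((x - t *: v - mu) *m invmx S *m (x - t *: v - mu)^T) 0 0 =
    (z *m invmx S *m z^T) 0 0 - 2 * t * b + t ^+ 2 * a.
  have -> : x - t *: v - mu = z - t *: v by rewrite zE addrAC.
  have bT : v *m invmx S *m z^T = (z *m invmx S *m v^T)^T.
    by rewrite !trmx_mul trmxK posdef_trmx_inv// mulmxA.
  have zT : (z - t *: v)^T = z^T - t *: v^T by rewrite linearB/= linearZ.
  have zS : (z - t *: v) *m invmx S = z *m invmx S - t *: (v *m invmx S).
    by rewrite mulmxBl -scalemxAl.
  rewrite zT zS mulmxBr !mulmxBl -!scalemxAr -!scalemxAl bT /b /a.
  move: (z *m invmx S *m z^T) (z *m invmx S *m v^T) (v *m invmx S *m v^T) => A B D.
  rewrite !mxE; ring.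
(* The peak of the normal density with standard deviation (1 + a)^(-1/2)
   compensates the factor of the determinant. *)
have key t : normal_pdf 0 1 t * normal_density mu S (x - t *: v) =
    normal_density mu (S + v^T *m v) x * normal_pdf m sg t.
  rewrite !normal_pdfE ?oner_eq0 ?gt_eqF// /normal_peak /normal_fun /normal_density.
  rewrite det_rank1_update// -/a [(_ * (1 + a)) `^ _]powRM ?(ltW dS) ?(ltW a1)//.
  rewrite [(1 + a) `^ _]powRN powR12_sqrt ?(ltW a1)//.
  rewrite -[sg ^+ 2 * pi *+ 2]mulrnAr sqrtrM ?sqr_ge0// sqrtr_sqr gtr0_norm// invfM invrK.
  rewrite inv_rank1_update_quadratic// -/a -zE -/b expand expr1n mul1r subr0.
  have r0 : Num.sqrt (1 + a) != 0 by rewrite gt_eqF// sqrtr_gt0.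
  have r2 : Num.sqrt (1 + a) ^+ 2 = 1 + a by rewrite sqr_sqrtr// ltW.
  set p := (Num.sqrt (pi *+ 2))^-1; set c := (2 * pi) `^ _; set D := \det S `^ _.
  set q := (z *m _ *m _) 0 0.
  set e1 := expR _; set e2 := expR _; set e3 := expR _; set e4 := expR _.
  have -> : p * e1 * (c * D * e2) = p * c * D * (e1 * e2) by ring.
  transitivity (p * c * D * (e3 * e4)); last by field.
  congr (_ * _); rewrite -!expRD; congr expR.
  rewrite /sg /m exprVn r2; field.
  exact: lt0r_neq0.
rewrite (@ge0_integral_density _ _ _ _ lebesgue_measure (normal_pdf 0 1))//; last 4 first.
- exact: measurable_normal_pdf.
- exact: normal_pdf_ge0.
- apply/measurable_EFinP; apply: measurable_normal_density_comp.
  apply: measurable_rV_sub => //; exact: measurable_rV_scale.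
- by move=> t; rewrite lee_fin normal_density_ge0.
under eq_integral do rewrite -EFinM key EFinM.
rewrite ge0_integralZl//; last 3 first.
- by apply/measurable_EFinP; exact: measurable_normal_pdf.
- by move=> t _; rewrite lee_fin normal_pdf_ge0.
- by rewrite lee_fin normal_density_ge0.
by rewrite integral_normal_pdf mule1.
Qed.

End gaussian_convolution.

Section scaled_location_mixtures.
Variables (R : realType) (d : nat).
Local Notation V := 'rV[R]_d.
Implicit Types (G : probability V R) (mu v y : V) (S : 'M[R]_d) (s : R).

(** The densities that correspond to location mixtures of the observations
    divided by s.  Working with them keeps all integrals in the original
    coordinates and avoids a linear change of variables. *)
Definition scaled_location_mixture s (h : V -> R) : Prop :=
  exists G, forall y, h y = s ^- d * location_mixture G (s^-1 *: y).

Lemma measurable_gaussian_kernel s y :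
  measurable_fun setT (fun t : V => (std_normal_density (s^-1 *: y - t))%:E).
Proof. by apply/measurable_EFinP; exact: measurable_std_normal_density_shift. Qed.

Lemma std_normal_density_ge0E y : (0%R <= (std_normal_density y)%:E)%E.
Proof. by rewrite lee_fin ltW// std_normal_density_gt0. Qed.

Lemma scaled_location_mixture_isotropic s mu : 0 < s ->
  scaled_location_mixture s (normal_density mu (s ^+ 2)%:M).
Proof.
move=> s0; exists \d_(s^-1 *: mu) => y.
have -> : location_mixture \d_(s^-1 *: mu) (s^-1 *: y) =
    std_normal_density (s^-1 *: y - s^-1 *: mu).
  apply/eqP; rewrite -eqe; apply/eqP; rewrite location_mixtureE integral_dirac//.
    by rewrite diracT mul1e.
  exact: measurable_gaussian_kernel.
rewrite scaled_std_normal_density// scalerA mulfV ?gt_eqF// scale1r.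
rewrite /normal_density det_scalar -exprM invmx_scalar mul_mx_scalar -scalemxAl mxE sqnorm2E.
congr (_ * expR (- _)); last by field; exact: lt0r_neq0.
rewrite mulrC; congr (_ * _).
rewrite -(powR_mulrn (2 * d) (ltW s0)) -powRrM mulrN powRN; congr (_ ^-1).
have -> : (2 * d)%N%:R / 2 = d%:R :> R by rewrite natrM; field.
by rewrite powR_mulrn// ltW.
Qed.

(** If G mixes to N(mu, S), then the law of theta + t v / s, with theta ~ G
    and t a standard normal independent of it, mixes to N(mu, S + v^T v). *)
Lemma scaled_location_mixture_rank1 s v S : 0 < s ->
  posdefmx S -> 0 < \det S ->
  (forall mu, scaled_location_mixture s (normal_density mu S)) ->
  forall mu, scaled_location_mixture s (normal_density mu (S + v^T *m v)).
Proof.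
move=> s0 pS dS mixS mu; have [G GE] := mixS mu.
pose phi (p : V * measurableTypeR R) : V := p.1 + p.2 *: (s^-1 *: v).
have mphi : measurable_fun setT phi.
  apply/measurable_fun_rVP => i; rewrite /phi; under eq_fun do rewrite !mxE.
  apply: measurable_funD; last by apply: measurable_funM.
  exact: (measurableT_comp (measurable_rV_coord i) measurable_fst).
pose phi_mixin := isMeasurableFun.Build _ _ _ _ _ mphi.
pose X : {mfun (V * measurableTypeR R)%type >-> V} := HB.pack phi phi_mixin.
pose P : probability (V * measurableTypeR R)%type R := (G \x normal_prob 0 1)%E.
exists (distribution P X) => y.
apply/eqP; rewrite -eqe; apply/eqP.
rewrite -normal_density_rank1_convolution// EFinM location_mixtureE.
rewrite ge0_integral_distribution//; last 2 first.
- exact: measurable_gaussian_kernel.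
- by move=> t; exact: std_normal_density_ge0E.
have m2 : measurable_fun setT (fun p => (std_normal_density (s^-1 *: y - X p))%:E).
  exact: (measurableT_comp (measurable_gaussian_kernel s y) mphi).
rewrite fubini_tonelli2//=; last by move=> p; exact: std_normal_density_ge0E.
rewrite /fubini_G -ge0_integralZl//; last 3 first.
- apply: measurable_fun_fubini_tonelli_G => //.
  by move=> p; exact: std_normal_density_ge0E.
- by move=> t _; apply: integral_ge0 => p _; exact: std_normal_density_ge0E.
- by rewrite lee_fin invr_ge0 exprn_ge0// ltW.
apply: eq_integral => t _ /=.
rewrite GE EFinM location_mixtureE; congr (_ * _)%E.
apply: eq_integral => th _; rewrite /phi /=; congr (std_normal_density _)%:E.
by rewrite scalerBr opprD addrA addrAC !scalerA [t * _]mulrC.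
Qed.

(** Starting from s^2 I, each rank-one update preserves membership in the class
    and does not decrease the determinant. *)
Lemma scaled_location_mixture_gaussian s S : 0 < s -> posdefmx S ->
  s ^+ 2 <= lambda_min S ->
  s ^+ (2 * d) <= \det S /\
  forall mu, scaled_location_mixture s (normal_density mu S).
Proof.
move=> s0 pS sS; have [l ->] := lambda_min_sum_rank1 pS sS.
suff: [/\ posdefmx ((s ^+ 2)%:M + \sum_(v <- l) v^T *m v),
    s ^+ (2 * d) <= \det ((s ^+ 2)%:M + \sum_(v <- l) v^T *m v) &
    forall mu, scaled_location_mixture s
      (normal_density mu ((s ^+ 2)%:M + \sum_(v <- l) v^T *m v))] by case.
elim: l => [|v l [pT dT mixT]].
  rewrite big_nil addr0; split.
  - split; first by rewrite tr_scalar_mx.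
    move=> x x0; rewrite mul_mx_scalar -scalemxAl mxE sqnorm2E.
    by rewrite mulr_gt0 ?exprn_gt0// sqnorm2_gt0.
  - by rewrite det_scalar -exprM.
  - by move=> mu; exact: scaled_location_mixture_isotropic.
have dT0 : 0 < \det ((s ^+ 2)%:M + \sum_(v <- l) v^T *m v).
  by apply: lt_le_trans dT; rewrite exprn_gt0.
rewrite big_cons [_ *m _ + _]addrC addrA; split.
- exact: posdef_rank1_update.
- rewrite det_rank1_update//; apply: le_trans dT _.
  by rewrite ler_peMr ?(ltW dT0)// lerDl posdef_inv_quadratic_ge0.
- exact: scaled_location_mixture_rank1.
Qed.

Lemma scaled_location_mixture_convex s k (w : 'I_k -> R) (h : 'I_k -> V -> R) :
  (forall j, 0 <= w j) -> \sum_(j < k) w j = 1 ->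
  (forall j, scaled_location_mixture s (h j)) ->
  scaled_location_mixture s (fun y => \sum_(j < k) w j * h j y).
Proof.
move=> w0 w1 /choice [G GE].
pose m_ (i : nat) : {measure set V -> \bar R} :=
  match insub i : option 'I_k with
  | Some j => mscale (NngNum (w0 j)) (G j)
  | None => mzero
  end.
have m_E (j : 'I_k) : m_ j = mscale (NngNum (w0 j)) (G j).
  by rewrite /m_ valK.
have mT : msum m_ k setT = 1%E.
  rewrite /msum/=; transitivity (\sum_(j < k) (w j)%:E)%E.
    apply: eq_bigr => j _; rewrite m_E /= /mscale/= [X in (_ * X)%E]probability_setT.
    by rewrite mule1.
  by rewrite sumEFin w1.
pose P : probability V R := HB.pack (msum m_ k) (Measure_isProbability.Build _ _ _ _ mT).
exists P => y; apply/eqP; rewrite -eqe; apply/eqP.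
rewrite EFinM location_mixtureE ge0_integral_measure_sum//; last 2 first.
- by move=> t _; exact: std_normal_density_ge0E.
- exact: measurable_gaussian_kernel.
rewrite -sumEFin ge0_sume_distrr; last first.
  by move=> j _; apply: integral_ge0 => t _; exact: std_normal_density_ge0E.
apply: eq_bigr => j _.
rewrite m_E ge0_integral_mscale//; last 2 first.
- exact: measurable_gaussian_kernel.
- by move=> t _; exact: std_normal_density_ge0E.
by rewrite GE !EFinM location_mixtureE/= muleCA.
Qed.

End scaled_location_mixtures.

(** * From brackets to the Hellinger risk *)

Lemma ge0_sum2_fin (R : realType) (A H : \bar R) :
  (0 <= A)%E -> (0 <= H)%E -> (H + 2%:E * A = 2%:E)%E ->
  exists a r : R, [/\ A = a%:E, H = r%:E & r + 2 * a = 2].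
Proof.
case: H => [r||]; case: A => [a||]//=.
- by move=> _ _ [ra]; exists a, r.
- by move=> _ _; rewrite mulry/= gtr0_sg// mul1e.
- by move=> _ _; rewrite mulry/= gtr0_sg// mul1e.
Qed.

Lemma measurable_sqrt_comp d (T : measurableType d) (R : realType)
    (f : T -> R) D : measurable_fun D f ->
  measurable_fun D (fun x => Num.sqrt (f x)).
Proof.
move=> mf; apply: (measurableT_comp _ mf).
exact: continuous_measurable_fun (@sqrt_continuous R).
Qed.

Section hellinger.
Context dT (T : measurableType dT) (R : realType) (m : {measure set T -> \bar R}).
Variable h : T -> R.
Hypotheses (mh : measurable_fun setT h) (h0 : forall x, 0 <= h x).
Hypothesis h1 : (\int[m]_x (h x)%:E = 1)%E.

Let measurable_sqrtM (p q : T -> R) D : measurable_fun setT p ->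
  measurable_fun setT q -> measurable_fun D (fun x => (Num.sqrt (p x * q x))%:E).
Proof.
move=> mp mq; apply/measurable_funTS/measurable_EFinP.
by apply: measurable_sqrt_comp; apply: measurable_funM.
Qed.

Variable f : T -> R.
Hypotheses (mf : measurable_fun setT f) (f0 : forall x, 0 <= f x).
Hypothesis f1 : (\int[m]_x (f x)%:E = 1)%E.

Let affinity := (\int[m]_x (Num.sqrt (f x * h x))%:E)%E.
Let sq_hell := (\int[m]_x ((Num.sqrt (f x) - Num.sqrt (h x)) ^+ 2)%:E)%E.

Let affinity_ge0 : (0 <= affinity)%E.
Proof. by apply: integral_ge0 => x _; rewrite lee_fin sqrtr_ge0. Qed.

Let sq_hell_ge0 : (0 <= sq_hell)%E.
Proof. by apply: integral_ge0 => x _; rewrite lee_fin sqr_ge0. Qed.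

Lemma hellinger_affinity : (sq_hell + 2%:E * affinity = 2%:E)%E.
Proof.
have mA : measurable_fun setT (fun x => (Num.sqrt (f x * h x))%:E).
  exact: measurable_sqrtM.
rewrite /affinity -ge0_integralZl//.
have two : 2%:E = (\int[m]_x (f x)%:E + \int[m]_x (h x)%:E)%E by rewrite f1 h1 -EFinD.
rewrite [RHS]two /sq_hell -ge0_integralD//=; last 3 first.
- by move=> x _; rewrite lee_fin sqr_ge0.
- apply/measurable_EFinP; apply: measurable_funX; apply: measurable_funB; exact: measurable_sqrt_comp.
- exact: measurable_funeM.
rewrite -[in RHS]ge0_integralD//=; last 4 first.
- by move=> x _; rewrite lee_fin.
- exact/measurable_EFinP.
- by move=> x _; rewrite lee_fin.
- exact/measurable_EFinP.
apply: eq_integral => x _; rewrite -EFinM -!EFinD sqrtrM//; congr EFin.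
rewrite -[in RHS](sqr_sqrtr (f0 x)) -[in RHS](sqr_sqrtr (h0 x)); ring.
Qed.

Lemma hellinger_le2 : (sq_hell <= 2%:E)%E.
Proof. by rewrite -hellinger_affinity leeDl// mule_ge0. Qed.

(** On S, sqrt (u h) exceeds sqrt (f h) by at most sqrt (e h), which is at most
    (t e + h / t) / 2 for every t > 0; integrating, the affinity of f and h is
    at least rho - (t e L + 1 / t) / 2. *)
Lemma hellinger_bracket (S : set T) (u : T -> R) (e L rho t : R) :
  measurable S -> (m S <= L%:E)%E -> measurable_fun setT u ->
  0 <= e -> 0 < t -> (forall x, S x -> f x <= u x <= f x + e) ->
  (\int[m]_(x in S) (Num.sqrt (u x * h x))%:E = rho%:E)%E ->
  (sq_hell <= (2 * (1 - rho) + (t * e * L + t^-1))%:E)%E.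
Proof.
move=> mS mSL mu e0 t0 fu rhoE.
have [a [r [aE rE ra]]] := ge0_sum2_fin affinity_ge0 sq_hell_ge0 hellinger_affinity.
have mA D : measurable_fun D (fun x => (Num.sqrt (f x * h x))%:E).
  exact: measurable_sqrtM.
have rho_le : rho <= a + 2^-1 * (t * e * L + t^-1).
  rewrite -lee_fin -rhoE.
  apply: (@le_trans _ _ (\int[m]_(x in S) ((Num.sqrt (f x * h x))%:E +
      (2^-1 * (t * e) + 2^-1 * t^-1 * h x)%:E))%E).
    apply: ge0_le_integral => //.
    - exact: measurable_sqrtM.
    - apply: emeasurable_funD => //; apply/measurable_funTS/measurable_EFinP.
      by apply: measurable_funD => //; apply: measurable_funM.
    - move=> x Sx; have /andP[fu1 fu2] := fu x Sx.
      rewrite -EFinD lee_fin; apply: (@le_trans _ _ (Num.sqrt (f x * h x) + Num.sqrt (e * h x))).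
        rewrite -[leRHS]ger0_norm ?addr_ge0 ?sqrtr_ge0//.
        rewrite -[leRHS]sqrtr_sqr ler_wsqrtr// sqrrD !sqr_sqrtr ?mulr_ge0//.
        apply: (@le_trans _ _ (f x * h x + e * h x)).
          by rewrite -mulrDl ler_wpM2r.
        by rewrite addrAC lerDl mulrn_wge0// mulr_ge0 ?sqrtr_ge0.
      rewrite lerD2l.
      have -> : e * h x = (t * e) * (t^-1 * h x) by field; exact: lt0r_neq0.
      have te0 : 0 <= t * e by rewrite mulr_ge0// ltW.
      have th0 : 0 <= t^-1 * h x by rewrite mulr_ge0// invr_ge0 ltW.
      rewrite sqrtrM// -mulrA -mulrDr.
      have := sqr_ge0 (Num.sqrt (t * e) - Num.sqrt (t^-1 * h x)).
      rewrite sqrrB !sqr_sqrtr// -mulr_natr; lra.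
  have mr D : measurable_fun D (fun x => (2^-1 * (t * e) + 2^-1 * t^-1 * h x)%:E).
    apply/measurable_funTS/measurable_EFinP.
    by apply: measurable_funD => //; apply: measurable_funM.
  rewrite ge0_integralD//; last first.
    by move=> x _; rewrite lee_fin addr_ge0// !mulr_ge0// ?invr_ge0// ltW.
  rewrite EFinD leeD//; first by rewrite -aE; apply: ge0_subset_integral.
  under eq_integral do rewrite EFinD.
  rewrite ge0_integralD//; last 3 first.
  - by move=> x _; rewrite lee_fin !mulr_ge0// ?invr_ge0// ltW.
  - by move=> x _; rewrite lee_fin !mulr_ge0// ?invr_ge0// ltW.
  - by apply/measurable_funTS/measurable_EFinP; apply: measurable_funM.
  rewrite mulrDr EFinD; apply: leeD.
    rewrite integral_cst// (mulrA _ (t * e)) [leRHS]EFinM lee_wpmul2l// lee_fin.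
    by rewrite !mulr_ge0// ltW.
  under eq_integral do rewrite EFinM.
  rewrite ge0_integralZl//; last 3 first.
  - by apply/measurable_funTS/measurable_EFinP.
  - by move=> x _; rewrite lee_fin.
  - by rewrite lee_fin mulr_ge0// invr_ge0 ltW.
  rewrite -[leRHS]mule1 lee_wpmul2l// ?lee_fin ?mulr_ge0 ?invr_ge0 ?(ltW t0)//.
  rewrite -h1; apply: ge0_subset_integral => //; first exact/measurable_EFinP.
  by move=> x _; rewrite lee_fin.
rewrite -/sq_hell rE lee_fin; lra.
Qed.

End hellinger.

Section bracketing_bound.
Context dT (T : measurableType dT) (R : realType) (m : {measure set T -> \bar R}).
Variable h : T -> R.
Hypotheses (mh : measurable_fun setT h) (h_gt0 : forall x, 0 < h x).
Hypothesis h1 : (\int[m]_x (h x)%:E = 1)%E.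
Context dO (Omega : measurableType dO) (P : probability Omega R).
Variables (n : nat) (Y : 'I_n -> {RV P >-> T}).
Hypotheses (n_gt0 : (0 < n)%N) (indep : mutually_independent Y).
Hypothesis law : forall i A, measurable A ->
  distribution P (Y i) A = (\int[m]_(x in A) (h x)%:E)%E.
Variables (S : set T) (L p e : R) (I : finType) (u : I -> T -> R).
Hypotheses (mS : measurable S) (mSL : (m S <= L%:E)%E).
Hypothesis pS : (\int[m]_(x in ~` S) (h x)%:E <= p%:E)%E.
Hypotheses (e_ge0 : 0 <= e) (I_gt0 : (0 < #|I|)%N).
Hypotheses (u_meas : forall j, measurable_fun setT (u j)) (u_ge0 : forall j x, 0 <= u j x).

Let h_ge0 x : 0 <= h x. Proof. exact: ltW. Qed.

Let brackets (f v : T -> R) := forall x, S x -> f x <= v x <= f x + e.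

(** Only indices that bracket some density are kept: for these the affinity
    on S is finite. *)
Let admissible j := `[< exists f : T -> R, [/\ measurable_fun setT f, forall x, 0 <= f x,
  (\int[m]_x (f x)%:E = 1)%E & brackets f (u j)] >].
Let aff (j : I) := (\int[m]_(x in S) (Num.sqrt (u j x * h x))%:E)%E.
Let rho j := fine (aff j).

Let affE j : admissible j -> aff j = (rho j)%:E.
Proof.
move=> /asboolP[f [mf f0 f1 fu]]; rewrite fineK// ge0_fin_numE; last first.
  by apply: integral_ge0 => x _; rewrite lee_fin sqrtr_ge0.
apply: (@le_lt_trans _ _ (\int[m]_(x in S) ((f x)%:E + ((e)%:E + (h x)%:E)))%E).
  apply: ge0_le_integral => //.
  - apply/measurable_funTS/measurable_EFinP/measurable_sqrt_comp.
    exact: measurable_funM.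
  - apply: emeasurable_funD; first exact/measurable_funTS/measurable_EFinP.
    apply: emeasurable_funD; first exact: measurable_cst.
    exact/measurable_funTS/measurable_EFinP.
  - move=> x Sx; have /andP[_ ux] := fu x Sx.
    rewrite -!EFinD lee_fin; apply: (@le_trans _ _ (u j x + h x)); last first.
      by rewrite addrA lerD2r.
    rewrite sqrtrM//; have := sqr_ge0 (Num.sqrt (u j x) - Num.sqrt (h x)).
    rewrite sqrrB !sqr_sqrtr// -mulr_natr.
    have := mulr_ge0 (sqrtr_ge0 (u j x)) (sqrtr_ge0 (h x)); lra.
rewrite ge0_integralD//; last 4 first.
- by move=> x _; rewrite lee_fin.
- exact/measurable_funTS/measurable_EFinP.
- by move=> x _; rewrite -EFinD lee_fin addr_ge0.
- apply: emeasurable_funD; first exact: measurable_cst.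
  exact/measurable_funTS/measurable_EFinP.
rewrite ge0_integralD//; last 2 first.
- by move=> x _; rewrite lee_fin.
- exact/measurable_funTS/measurable_EFinP.
have le1 (g : T -> R) : measurable_fun setT g -> (forall x, 0 <= g x) ->
    (\int[m]_x (g x)%:E = 1)%E -> (\int[m]_(x in S) (g x)%:E < +oo)%E.
  move=> mg g0 g1; apply: (@le_lt_trans _ _ 1%E); last exact: ltry.
  rewrite -g1; apply: ge0_subset_integral => //; first exact/measurable_EFinP.
  by move=> x _; rewrite lee_fin.
apply: lte_add_pinfty; first exact: le1.
apply: lte_add_pinfty; last exact: le1.
rewrite integral_cst//; apply: (@le_lt_trans _ _ (e%:E * L%:E)%E); last exact: ltry.
by rewrite lee_wpmul2l ?lee_fin.
Qed.

(** One factor of the square root of the likelihood ratio, cut off outside S;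
    its expectation under h is the affinity on S. *)
Let g j (x : T) : R := \1_S x * Num.sqrt (u j x / h x).

Let g_ge0 j x : 0 <= g j x.
Proof. by rewrite mulr_ge0 ?sqrtr_ge0. Qed.

Let mg j : measurable_fun setT (g j).
Proof.
apply: measurable_funM => //; apply: measurable_sqrt_comp; apply: measurable_funM => //.
rewrite (_ : (fun x => _) = (fun x => h x `^ (-1))).
  exact: (measurableT_comp (measurable_powR _) mh).
by apply/funext => x; rewrite powR_inv1.
Qed.

Let Eg j i : admissible j -> (\int[P]_w (g j (Y i w))%:E = (rho j)%:E)%E.
Proof.
move=> adm_j; rewrite -affE//.
have := @ge0_integral_distribution _ _ _ _ _ P (Y i) (fun y => (g j y)%:E).
move=> /(_ _ _)/= <-//; last 2 first.
- exact/measurable_EFinP.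
- by move=> y; rewrite lee_fin.
rewrite (@ge0_integral_density _ _ _ _ m h mh h_ge0)//; last 3 first.
- exact: law.
- exact/measurable_EFinP.
- by move=> y; rewrite lee_fin.
rewrite /aff [RHS]integral_mkcond; apply: eq_integral => x _.
rewrite patchE -EFinM /g indicE; case: ifPn => _; last by rewrite mul0r mulr0.
rewrite mul1r; congr EFin.
rewrite -{1}(sqr_sqrtr (h_ge0 x)) expr2 -mulrA -sqrtrM// mulrCA mulfV ?gt_eqF//.
by rewrite mulr1 mulrC -sqrtrM.
Qed.

Let Z j (w : Omega) : R := \prod_(i < n) g j (Y i w).

Let Z_ge0 j w : 0 <= Z j w. Proof. by apply: prodr_ge0. Qed.

Let mZ j : measurable_fun setT (Z j).
Proof. by apply: measurable_prod => i _; apply: measurableT_comp. Qed.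

Let EZ j : admissible j -> (\int[P]_w (Z j w)%:E = (rho j ^+ n)%:E)%E.
Proof.
move=> adm_j; rewrite (@expectation_prod_independent _ _ _ _ _ _ _ Y (fun=> g j) (fun=> rho j))//.
- by rewrite prodr_const card_ord.
- by move=> i; exact: Eg.
Qed.

Let N : R := #|I|%:R.
Let c j := expR (n%:R * (1 - rho j)) / N.
(** The average of Z_j exp (n (1 - rho_j)) over the brackets.  Its expectation
    is at most 1 because rho exp (1 - rho) <= 1. *)
Let W (w : Omega) : R := \sum_(j | admissible j) c j * Z j w.

Let N_gt0 : 0 < N. Proof. by rewrite ltr0n. Qed.
Let c_ge0 j : 0 <= c j. Proof. by rewrite divr_ge0 ?expR_ge0// ltW. Qed.
Let W_ge0 w : 0 <= W w.
Proof. by apply: sumr_ge0 => j _; rewrite mulr_ge0. Qed.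

Let mW : measurable_fun setT W.
Proof.
rewrite /W; under eq_fun do rewrite big_mkcond.
apply: measurable_sum => j; case: (admissible j) => //.
by apply: measurable_funM.
Qed.

Let EW : (\int[P]_w (W w)%:E <= 1)%E.
Proof.
under eq_integral do rewrite /W -sumEFin big_mkcond.
rewrite ge0_integral_sum//; last 2 first.
- move=> j; case: (admissible j) => //; apply/measurable_EFinP; exact: measurable_funM.
- by move=> j w _; case: (admissible j) => //; rewrite lee_fin mulr_ge0.
apply: (@le_trans _ _ (\sum_(j : I) (N^-1)%:E)%E); last first.
  by rewrite sumEFin sumr_const -[_ *+ _]mulr_natl mulfV// gt_eqF//.
apply: lee_sum => j _; case: (boolP (admissible j)) => [adm_j|_]; last first.
  by rewrite integral0 lee_fin invr_ge0 ltW.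
under eq_integral do rewrite EFinM.
rewrite ge0_integralZl//; last 3 first.
- exact/measurable_EFinP.
- by move=> w _; rewrite lee_fin.
- by rewrite lee_fin.
rewrite EZ// -EFinM lee_fin /c mulrAC -[leRHS]mul1r ler_wpM2r ?invr_ge0 ?(ltW N_gt0)//.
rewrite expRM_natl -exprMn.
have rho0 : 0 <= rho j.
  by rewrite fine_ge0//; apply: integral_ge0 => x _; rewrite lee_fin sqrtr_ge0.
rewrite exprn_ile1 ?mulr_ge0 ?expR_ge0//.
rewrite -[leRHS](expRxMexpNx_1 (1 - rho j)) ler_wpM2l ?expR_ge0//.
by have := expR_ge1Dx (- (1 - rho j)); lra.
Qed.

(** Union bound for the event that the sample leaves S. *)
Let B (w : Omega) : R := \sum_(i < n) \1_(Y i @^-1` ~` S) w.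

Let mB : measurable_fun setT B.
Proof.
apply: measurable_sum => i; apply: measurable_indic.
by rewrite -[X in measurable X]setTI; apply: measurable_funP => //; exact: measurableC.
Qed.

Let B_ge0 w : 0 <= B w. Proof. by apply: sumr_ge0. Qed.

Let EB : (\int[P]_w (B w)%:E <= (n%:R * p)%:E)%E.
Proof.
have mYS i : measurable (Y i @^-1` ~` S).
  by rewrite -[X in measurable X]setTI; apply: measurable_funP => //; exact: measurableC.
under eq_integral do rewrite /B -sumEFin.
rewrite ge0_integral_sum//; last first.
  by move=> i; apply/measurable_EFinP; exact: measurable_indic.
rewrite mulr_natl -[in leRHS](card_ord n) -sumr_const -sumEFin.
apply: lee_sum => i _; rewrite integral_indic// setIT.
by apply: le_trans pS; rewrite -(law i)//; exact: measurableC.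
Qed.

Variable fhat : Omega -> T -> R.
Hypotheses (mfhat : forall w, measurable_fun setT (fhat w))
  (fhat_gt0 : forall w x, 0 < fhat w x)
  (fhat1 : forall w, (\int[m]_x (fhat w x)%:E = 1)%E)
  (fhat_bracket : forall w, exists j, forall x, S x ->
     fhat w x <= u j x <= fhat w x + e)
  (fhat_likelihood : forall w,
     \prod_(i < n) h (Y i w) <= \prod_(i < n) fhat w (Y i w)).

Let bound w := 2 * B w + (n%:R * e * L + n%:R^-1) + 2 / n%:R * (ln N + W w).

Let hellinger_le_bound w :
  (\int[m]_x ((Num.sqrt (fhat w x) - Num.sqrt (h x)) ^+ 2)%:E <= (bound w)%:E)%E.
Proof.
have n0 : 0 < n%:R :> R by rewrite ltr0n.
have L0 : 0 <= L by rewrite -lee_fin; apply: le_trans mSL.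
have lnN0 : 0 <= ln N by rewrite ln_ge0// ler1n.
(* Outside the event that the sample lies in S the trivial bound 2 is used. *)
have [YS|/existsNP[i YiS]] := pselect (forall i, S (Y i w)); last first.
  apply: (@le_trans _ _ 2%:E).
    by apply: hellinger_le2 => // x; exact: ltW.
  rewrite lee_fin /bound.
  have B1 : 1 <= B w.
    rewrite /B (bigD1 i)//= indicE mem_set//= lerDl.
    by apply: sumr_ge0.
  have : 0 <= n%:R * e * L + n%:R^-1 by rewrite addr_ge0 ?mulr_ge0 ?invr_ge0 ?(ltW n0).
  have : 0 <= 2 / n%:R * (ln N + W w).
    by rewrite mulr_ge0 ?divr_ge0 ?addr_ge0 ?(ltW n0).
  lra.
have [j fj] := fhat_bracket w.
have adm_j : admissible j.
  by apply/asboolP; exists (fhat w); split => // x; exact: ltW.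
apply: le_trans (hellinger_bracket mh h_ge0 h1 (mfhat w) _ (fhat1 w) mS mSL
  (u_meas j) e_ge0 n0 fj (affE adm_j)) _.
  by move=> x; exact: ltW.
rewrite lee_fin /bound.
suff : n%:R * (1 - rho j) <= ln N + W w.
  move=> H; have : 1 - rho j <= n%:R^-1 * (ln N + W w) by rewrite ler_pdivlMl.
  have := B_ge0 w; lra.
have Z1 : 1 <= Z j w.
  apply: (@le_trans _ _ (\prod_(i < n) Num.sqrt (fhat w (Y i w) / h (Y i w)))).
    rewrite -(@expr_ge1 _ 2)//; last by apply: prodr_ge0 => i _; exact: sqrtr_ge0.
    rewrite -prodrXl (eq_bigr (fun i => fhat w (Y i w) / h (Y i w))); last first.
      by move=> i _; rewrite sqr_sqrtr// divr_ge0// ltW.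
    rewrite prodf_div ler_pdivlMr ?mul1r//.
    by apply: prodr_gt0.
  apply: ler_prod => i _; rewrite sqrtr_ge0/= /g indicE mem_set// mul1r.
  apply: ler_wsqrtr; rewrite ler_wpM2r ?invr_ge0//.
  by have /andP[] := fj _ (YS i).
have cW : c j <= W w.
  rewrite /W (bigD1 j)//=; apply: (@le_trans _ _ (c j * Z j w)).
    by rewrite ler_peMr.
  by rewrite lerDl; apply: sumr_ge0 => k _; rewrite mulr_ge0.
rewrite -lerBlDl; apply: le_trans cW.
(* y <= exp y at y = n (1 - rho_j) - ln N *)
have := expR_ge1Dx (n%:R * (1 - rho j) - ln N).
by rewrite expRD expRN lnK ?posrE// -/(c j); lra.
Qed.

(** Integrates the pointwise bound; only the fixed functions B and W of the
    sample are integrated, never the estimator. *)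
Lemma bracketing_hellinger_bound :
  (\int[P]_w \int[m]_x ((Num.sqrt (fhat w x) - Num.sqrt (h x)) ^+ 2)%:E <=
   (2 * (n%:R * p) + (n%:R * e * L + n%:R^-1) + 2 / n%:R * (ln N + 1))%:E)%E.
Proof.
have n0 : 0 < n%:R :> R by rewrite ltr0n.
have L0 : 0 <= L by rewrite -lee_fin; apply: le_trans mSL.
have lnN0 : 0 <= ln N by rewrite ln_ge0// ler1n.
apply: (@le_trans _ _ (\int[P]_w (bound w)%:E)%E).
  apply: le_lower_integral => w; rewrite hellinger_le_bound andbT.
  by apply: integral_ge0 => x _; rewrite lee_fin sqr_ge0.
have boundE w : (bound w)%:E = (2%:E * (B w)%:E +
    ((n%:R * e * L + n%:R^-1 + 2 / n%:R * ln N)%:E + (2 / n%:R)%:E * (W w)%:E))%E.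
  by rewrite /bound -!EFinM -!EFinD; congr EFin; ring.
under eq_integral do rewrite boundE.
have K0 : 0 <= n%:R * e * L + n%:R^-1 + 2 / n%:R * ln N.
  by rewrite !addr_ge0 ?mulr_ge0 ?invr_ge0 ?(ltW n0).
have K1 : 0 <= 2 / n%:R :> R by rewrite divr_ge0// ltW.
rewrite ge0_integralD//; last 4 first.
- by move=> w _; rewrite mule_ge0// lee_fin.
- by apply: measurable_funeM; exact/measurable_EFinP.
- by move=> w _; rewrite adde_ge0 ?mule_ge0 ?lee_fin.
- apply: emeasurable_funD; first exact: measurable_cst.
  by apply: measurable_funeM; exact/measurable_EFinP.
rewrite ge0_integralD//; last 2 first.
- by move=> w _; rewrite mule_ge0 ?lee_fin.
- by apply: measurable_funeM; exact/measurable_EFinP.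
rewrite !ge0_integralZl//; last 4 first.
- exact/measurable_EFinP.
- by move=> w _; rewrite lee_fin.
- exact/measurable_EFinP.
- by move=> w _; rewrite lee_fin.
rewrite integral_cst// [X in (_ + (_ * X + _))%E]probability_setT mule1.
apply: (@le_trans _ _ (2%:E * (n%:R * p)%:E +
    ((n%:R * e * L + n%:R^-1 + 2 / n%:R * ln N)%:E + (2 / n%:R)%:E * 1%:E))%E).
  by apply: leeD; [|apply: leeD => //]; apply: lee_wpmul2l; rewrite ?lee_fin.
by rewrite -!EFinM -!EFinD lee_fin; lra.
Qed.

End bracketing_bound.

(** * Expansion of the Gaussian kernel *)

Section gaussian_kernel_expansion.
Variable R : realType.
Implicit Types x y t : R.

Lemma exp_partial_sum_le y n : 0 <= y -> \sum_(a < n) y ^+ a / a`!%:R <= expR y.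
Proof.
move=> y0; rewrite -(big_mkord predT (fun a => y ^+ a / a`!%:R)).
apply: (@nondecreasing_cvgn_le _ (series (exp_coeff y))); last exact: is_cvg_series_exp_coeff.
by apply/nondecreasing_series => k _ _; exact: exp_coeff_ge0.
Qed.

(** In the remainder a >= m, hence |y|^a <= 2^-m (2 |y|)^a, and what is left is
    part of the series of exp (2 |y|). *)
Lemma exp_taylor_remainder y m :
  `|expR y - \sum_(a < m) y ^+ a / a`!%:R| <= 2 ^- m * expR (2 * `|y|).
Proof.
set S := \sum_(a < m) _.
have cv : (fun n => `|series (exp_coeff y) n - S|) @ \oo --> `|expR y - S|.
  apply: cvg_norm; apply: cvgB; last exact: cvg_cst.
  exact: is_cvg_series_exp_coeff.
rewrite -(cvg_lim _ cv)//; apply: limr_le; first by apply/cvgP; exact: cv.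
near=> n.
have mn : (m <= n)%N by near: n; exact: nbhs_infty_ge.
have -> : series (exp_coeff y) n - S = \sum_(m <= a < n) y ^+ a / a`!%:R.
  rewrite /series/= /S -(big_mkord predT (fun a => y ^+ a / a`!%:R)).
  by rewrite (@big_cat_nat _ _ _ m)//= addrAC subrr add0r.
apply: le_trans (ler_norm_sum _ _ _) _.
apply: (@le_trans _ _ (\sum_(m <= a < n) 2 ^- m * ((2 * `|y|) ^+ a / a`!%:R))).
  rewrite big_nat_cond [leRHS]big_nat_cond; apply: ler_sum => a; rewrite andbT => /andP[ma _].
  rewrite normrM normrX [`|_^-1|]ger0_norm// exprMn mulrA mulrA ler_wpM2r//.
  rewrite ler_peMl ?exprn_ge0// mulrC ler_pdivlMr ?exprn_gt0// mul1r.
  by rewrite ler_eXn2l// ltr1n.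
rewrite -mulr_sumr ler_wpM2l ?invr_ge0 ?exprn_ge0//.
have y0 : 0 <= 2 * `|y| by rewrite mulr_ge0.
apply: le_trans (exp_partial_sum_le n y0).
rewrite -[leRHS](big_mkord predT (fun a => (2 * `|y|) ^+ a / a`!%:R)).
rewrite [leRHS](@big_cat_nat _ _ _ m)//= lerDr; apply: sumr_ge0 => a _.
by rewrite divr_ge0// exprn_ge0.
Unshelve. all: by end_near. Qed.

(** The squares of these functions sum to 1 over a: they are the coordinates of
    a unit vector of l^2, and the Gaussian kernel exp (-(x - t)^2 / 2) is the
    inner product of the vectors attached to x and t. *)
Definition gaussian_feature a x : R :=
  x ^+ a * expR (- (x ^+ 2 / 2)) / Num.sqrt a`!%:R.

Definition truncated_kernel m x t : R :=
  \sum_(a < m) gaussian_feature a x * gaussian_feature a t.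

Lemma truncated_kernelE m x t : truncated_kernel m x t =
  expR (- (x ^+ 2 / 2)) * expR (- (t ^+ 2 / 2)) * \sum_(a < m) (x * t) ^+ a / a`!%:R.
Proof.
rewrite /truncated_kernel mulr_sumr; apply: eq_bigr => a _; rewrite /gaussian_feature.
have f0 : a`!%:R > 0 :> R by rewrite ltr0n fact_gt0.
have s0 : Num.sqrt a`!%:R != 0 :> R by rewrite gt_eqF// sqrtr_gt0.
rewrite -[in RHS](sqr_sqrtr (ltW f0)) exprMn; field.
exact: s0.
Qed.

Lemma gaussian_kernelE x t : expR (- ((x - t) ^+ 2 / 2)) =
  expR (- (x ^+ 2 / 2)) * expR (- (t ^+ 2 / 2)) * expR (x * t).
Proof. by rewrite -!expRD; congr expR; field. Qed.

(** The square is a single term of the series of exp (x^2), times exp (-x^2). *)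
Lemma gaussian_feature_le1 a x : `|gaussian_feature a x| <= 1.
Proof.
rewrite -(@expr_le1 _ 2)// -normrX ger0_norm ?sqr_ge0//.
rewrite /gaussian_feature !exprMn exprVn sqr_sqrtr// -expRM_natl.
have -> : 2 * - (x ^+ 2 / 2) = - x ^+ 2 by field.
rewrite expRN mulrAC ler_pdivrMr ?expR_gt0// mul1r -exprM mulnC exprM.
apply: le_trans (exp_partial_sum_le a.+1 (sqr_ge0 x)).
rewrite big_ord_recr/= lerDr; apply: sumr_ge0 => i _.
by rewrite divr_ge0// exprn_ge0// sqr_ge0.
Qed.

Lemma truncated_kernel_le1 m x t : `|truncated_kernel m x t| <= 1.
Proof.
rewrite truncated_kernelE normrM ger0_norm ?mulr_ge0 ?expR_ge0//.
apply: (@le_trans _ _ (expR (- (x ^+ 2 / 2)) * expR (- (t ^+ 2 / 2)) * expR `|x * t|)).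
  rewrite ler_wpM2l ?mulr_ge0 ?expR_ge0//.
  apply: le_trans (exp_partial_sum_le m (normr_ge0 _)).
  apply: le_trans (ler_norm_sum _ _ _) _; apply: ler_sum => a _.
  by rewrite normrM normrX [`|_^-1|]ger0_norm.
rewrite -!expRD -[leRHS]expR0 ler_expR normrM.
rewrite -[x ^+ 2]real_normK ?num_real// -[t ^+ 2]real_normK ?num_real//.
have := sqr_ge0 (`|x| - `|t|); rewrite sqrrB; lra.
Qed.

(** Uniform in t, because 2 |x t| - t^2 / 2 <= 2 x^2: a mixing distribution
    needs no truncation. *)
Lemma truncated_kernel_error m x t :
  `|expR (- ((x - t) ^+ 2 / 2)) - truncated_kernel m x t| <=
  2 ^- m * expR (3 / 2 * x ^+ 2).
Proof.
rewrite gaussian_kernelE truncated_kernelE -mulrBr normrM ger0_norm ?mulr_ge0 ?expR_ge0//.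
apply: le_trans (ler_wpM2l _ (exp_taylor_remainder _ _)) _.
  by rewrite mulr_ge0 ?expR_ge0.
rewrite mulrCA ler_wpM2l ?invr_ge0 ?exprn_ge0// -!expRD ler_expR normrM.
rewrite -[x ^+ 2]real_normK ?num_real// -[t ^+ 2]real_normK ?num_real//.
have := sqr_ge0 (2 * `|x| - `|t|); rewrite sqrrB exprMn; lra.
Qed.

Lemma measurable_gaussian_feature a : measurable_fun setT (gaussian_feature a).
Proof.
apply: measurable_funM => //; apply: measurable_funM => //.
apply: measurableT_comp => //; apply: measurableT_comp => //.
exact: measurable_funM.
Qed.

Lemma prod_diff_le d (p q : 'I_d -> R) (e : R) :
  (forall i, `|p i| <= 1) -> (forall i, `|q i| <= 1) ->
  (forall i, `|p i - q i| <= e) ->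
  `|\prod_(i < d) p i - \prod_(i < d) q i| <= d%:R * e.
Proof.
elim: d p q => [|d IH] p q p1 q1 pq; first by rewrite !big_ord0 subrr normr0 mul0r.
rewrite !big_ord_recl; set P := \prod_(i < d) p _; set Q := \prod_(i < d) q _.
have -> : p ord0 * P - q ord0 * Q = (p ord0 - q ord0) * P + q ord0 * (P - Q) by ring.
apply: le_trans (ler_normD _ _) _; rewrite !normrM -natr1 mulrDl mul1r addrC.
apply: lerD.
  apply: le_trans (IH _ _ (fun i => p1 (lift ord0 i)) (fun i => q1 (lift ord0 i))
    (fun i => pq (lift ord0 i))).
  by rewrite ler_piMl.
apply: le_trans (pq ord0); rewrite ler_piMr// /P normr_prod.
by apply: prodr_ile1 => i _; rewrite normr_ge0 p1.
Qed.

End gaussian_kernel_expansion.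

Section bounded_expectation.
Context dT (T : measurableType dT) (R : realType) (G : probability T R).

Lemma integrable_bounded (f : T -> R) (M : R) : measurable_fun setT f ->
  (forall t, `|f t| <= M) -> G.-integrable setT (EFin \o f).
Proof.
move=> mf fM; apply: measurable_bounded_integrable => //.
  by rewrite [X in (X < _)%E]probability_setT ltry.
exists M; split; first exact: num_real.
by move=> x Mx t _ /=; apply: le_trans (fM t) (ltW Mx).
Qed.

Lemma Rintegral_bounded (f : T -> R) (M : R) : measurable_fun setT f ->
  (forall t, `|f t| <= M) -> `|\int[G]_t f t| <= M.
Proof.
move=> mf fM; apply: le_trans (le_normr_Rintegral _ _) _ => //.
  exact: integrable_bounded fM.
have -> : M = \int[G]_t cst M t.
  by rewrite Rintegral_cst// [X in fine X]probability_setT/= mulr1.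
apply: le_Rintegral => //.
- apply: (@integrable_bounded (fun t => `|f t|) M); first exact: measurableT_comp.
  by move=> t; rewrite normr_id.
- exact: (@integrable_bounded (cst M) `|M|).
Qed.

Lemma Rintegral_finite_sum (I : finType) (c : I -> R) (psi : I -> T -> R) :
  (forall i, measurable_fun setT (psi i)) -> (forall i t, `|psi i t| <= 1) ->
  \int[G]_t (\sum_i c i * psi i t) = \sum_i c i * \int[G]_t psi i t.
Proof.
move=> mpsi psi1; rewrite /Rintegral.
under eq_integral do rewrite -sumEFin.
rewrite integral_sum//; last first.
  move=> i; apply: (@integrable_bounded (fun t => c i * psi i t) `|c i|).
    exact: measurable_funM.
  by move=> t; rewrite normrM ler_piMr.
rewrite -sum_fine; last first.
  move=> i _; apply: integrable_fin_num => //.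
  apply: (@integrable_bounded (fun t => c i * psi i t) `|c i|).
    exact: measurable_funM.
  by move=> t; rewrite normrM ler_piMr.
apply: eq_bigr => i _.
rewrite -[LHS]/(\int[G]_t (c i * psi i t)) RintegralZl//.
exact: integrable_bounded (psi1 i).
Qed.

Lemma Rintegral_approx (I : finType) (F : T -> R) (c : I -> R)
    (psi : I -> T -> R) (e : R) :
  measurable_fun setT F -> (forall i, measurable_fun setT (psi i)) ->
  (forall i t, `|psi i t| <= 1) ->
  (forall t, `|F t - \sum_i c i * psi i t| <= e) ->
  `|\int[G]_t F t - \sum_i c i * \int[G]_t psi i t| <= e.
Proof.
move=> mF mpsi psi1 Fe; rewrite -Rintegral_finite_sum//.
have mS : measurable_fun setT (fun t => \sum_i c i * psi i t).
  by apply: measurable_sum => i; apply: measurable_funM.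
have bS t : `|\sum_i c i * psi i t| <= \sum_i `|c i|.
  apply: le_trans (ler_norm_sum _ _ _) _; apply: ler_sum => i _.
  by rewrite normrM ler_piMr.
have bF t : `|F t| <= e + \sum_i `|c i|.
  by rewrite -(subrK (\sum_i c i * psi i t) (F t)); apply: le_trans (ler_normD _ _) (lerD _ _).
rewrite -RintegralB//; [|exact: integrable_bounded bF|exact: integrable_bounded bS].
by apply: Rintegral_bounded Fe; exact: measurable_funB.
Qed.

End bounded_expectation.

(** * Brackets for rescaled location mixtures *)

Section mixture_brackets.
Variables (R : realType) (d : nat) (s A : R).
Hypotheses (s_gt0 : 0 < s) (A_ge0 : 0 <= A).
Local Notation V := 'rV[R]_d.
Implicit Types (G : probability V R) (c y : V).

Definition scaled_peak : R := s ^- d * (2 * pi) `^ (- (d%:R / 2)).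

Lemma scaled_peak_ge0 : 0 <= scaled_peak.
Proof. by rewrite mulr_ge0 ?powR_ge0// invr_ge0 exprn_ge0// ltW. Qed.

Definition local_feature m (c : V) (alpha : {ffun 'I_d -> 'I_m}) (y : V) : R :=
  \prod_(i < d) gaussian_feature (alpha i) ((y ord0 i - c ord0 i) / s).

Definition feature_moment m G c (alpha : {ffun 'I_d -> 'I_m}) : R :=
  \int[G]_theta \prod_(i < d) gaussian_feature (alpha i) (theta ord0 i - c ord0 i / s).

Definition local_expansion m c (M : {ffun 'I_d -> 'I_m} -> R) y : R :=
  scaled_peak * \sum_alpha M alpha * local_feature c alpha y.

(** The radius is s A because the kernel expansion is applied to coordinates
    divided by s, which have to stay below A. *)
Definition cube c : set V := [set y | forall i, `|y ord0 i - c ord0 i| <= s * A].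

Let mprod_feature m c (alpha : {ffun 'I_d -> 'I_m}) :
  measurable_fun [set: V] (fun theta : V =>
    \prod_(i < d) gaussian_feature (alpha i) (theta ord0 i - c ord0 i / s)).
Proof.
apply: measurable_prod => i _.
have mi : measurable_fun [set: V] (fun theta : V => theta ord0 i - c ord0 i / s).
  by apply: measurable_funB => //; exact: measurable_rV_coord.
exact: (measurableT_comp (measurable_gaussian_feature (alpha i)) mi).
Qed.

Lemma prod_feature_le1 m (alpha : {ffun 'I_d -> 'I_m}) (x : 'I_d -> R) :
  `|\prod_(i < d) gaussian_feature (alpha i) (x i)| <= 1.
Proof.
rewrite normr_prod; apply: prodr_ile1 => i _.
by rewrite normr_ge0 gaussian_feature_le1.
Qed.

Lemma feature_moment_le1 m G c (alpha : {ffun 'I_d -> 'I_m}) :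
  `|feature_moment G c alpha| <= 1.
Proof.
apply: Rintegral_bounded => [|t]; first exact: mprod_feature.
exact: prod_feature_le1.
Qed.

(** Integrating over theta the product over the coordinates of the truncated
    kernels gives a linear combination of the features of y, whose
    coefficients are moments of G. *)
Lemma local_expansion_error m G c y : cube c y ->
  `|s ^- d * location_mixture G (s^-1 *: y) -
    local_expansion c (feature_moment (m := m) G c) y| <=
  scaled_peak * (d%:R * (2 ^- m * expR (3 / 2 * A ^+ 2))).
Proof.
move=> cy; have s0 : s != 0 by exact: lt0r_neq0.
pose x i := (y ord0 i - c ord0 i) / s.
pose t (theta : V) i := theta ord0 i - c ord0 i / s.
pose F theta := \prod_(i < d) expR (- ((x i - t theta i) ^+ 2 / 2)).
have mF : measurable_fun setT F.
  apply: measurable_prod => i _; apply: measurableT_comp => //.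
  apply: measurableT_comp => //; apply: measurable_funM => //.
  apply: measurable_funX; apply: measurable_funB => //.
  by apply: measurable_funB => //; exact: measurable_rV_coord.
have K1 (z : R) : `|expR (- (z ^+ 2 / 2))| <= 1.
  by rewrite ger0_norm ?expR_ge0// -[leRHS]expR0 ler_expR oppr_le0 divr_ge0// sqr_ge0.
have F1 theta : `|F theta| <= 1.
  by rewrite normr_prod; apply: prodr_ile1 => i _; rewrite normr_ge0 K1.
have -> : s ^- d * location_mixture G (s^-1 *: y) = scaled_peak * \int[G]_theta F theta.
  rewrite -mulrA; congr (_ * _); rewrite -RintegralZl//; last first.
    exact: integrable_bounded F1.
  congr fine; apply: eq_integral => theta _; congr EFin.
  rewrite /std_normal_density /F -expR_sum; congr (_ * expR _).
  rewrite sumrN /sqnorm2 mulr_suml; congr (- _); apply: eq_bigr => i _.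
  by rewrite !mxE /x /t; congr (_ ^+ 2 / _); field.
rewrite /local_expansion -mulrBr normrM ger0_norm ?scaled_peak_ge0//.
rewrite ler_wpM2l ?scaled_peak_ge0//.
under eq_bigr do rewrite mulrC.
apply: Rintegral_approx => //.
- by move=> alpha theta; exact: prod_feature_le1.
move=> theta; rewrite /local_feature.
(* The product over the coordinates of the sums over the degree expands over
   the multi-indices alpha. *)
have -> : \sum_(alpha : {ffun 'I_d -> 'I_m})
    \prod_(i < d) gaussian_feature (alpha i) ((y ord0 i - c ord0 i) / s) *
    \prod_(i < d) gaussian_feature (alpha i) (theta ord0 i - c ord0 i / s) =
    \prod_(i < d) truncated_kernel m (x i) (t theta i).
  rewrite bigA_distr_bigA; apply: eq_bigr => alpha _.
  by rewrite -big_split.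
apply: prod_diff_le => i; [exact: K1|exact: truncated_kernel_le1|].
apply: le_trans (truncated_kernel_error _ _ _) _.
rewrite ler_wpM2l ?invr_ge0 ?exprn_ge0// ler_expR ler_wpM2l// ?divr_ge0//.
rewrite -[leLHS]real_normK ?num_real// ler_sqr ?nnegrE// /x normrM.
by rewrite [`|s^-1|]gtr0_norm ?invr_gt0// ler_pdivrMr// mulrC.
Qed.

Definition grid_point T (t : 'I_T.+1) : R := -1 + 2 * t%:R / T%:R.

Lemma grid_rounding T (a : R) : (0 < T)%N -> `|a| <= 1 ->
  exists t : 'I_T.+1, `|grid_point t - a| <= 2 / T%:R.
Proof.
move=> T0; rewrite ler_norml => /andP[a1 a2].
have T0' : 0 < T%:R :> R by rewrite ltr0n.
pose z := (a + 1) / 2 * T%:R.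
have z0 : 0 <= z by rewrite !mulr_ge0//; lra.
have /andP[z1 z2] := Num.Theory.truncn_itv z0.
have tT : (Num.truncn z < T.+1)%N.
  rewrite ltnS -(ler_nat R); apply: (le_trans z1).
  by rewrite /z ger_pMl//; lra.
exists (Ordinal tT); rewrite /grid_point/=; set t := _%:R in z1 *.
have -> : -1 + 2 * t / T%:R - a = 2 / T%:R * (t - z).
  by rewrite /z; field; exact: lt0r_neq0.
rewrite normrM ger0_norm; last by rewrite divr_ge0// ltW.
rewrite ler_piMr ?divr_ge0 ?(ltW T0')// ler_norml.
move: z2; rewrite -natr1 -/t => z2; apply/andP; split; lra.
Qed.

Variables (m T : nat) (Q : finType) (center : Q -> V).
Hypothesis T_gt0 : (0 < T)%N.

Definition bracket_width : R := scaled_peak *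
  (d%:R * (2 ^- m * expR (3 / 2 * A ^+ 2)) + (m ^ d)%:R * (2 / T%:R)).

Definition bracket_index := {ffun Q * {ffun 'I_d -> 'I_m} -> 'I_T.+1}.

Definition bracket_piece (t : bracket_index) q y : R :=
  \1_(cube (center q)) y *
  (local_expansion (center q) (fun alpha => grid_point (t (q, alpha))) y + bracket_width).

(** A maximum over the cubes containing y, rather than a choice among them,
    keeps the function measurable; any cube containing y gives an admissible
    value. *)
Definition upper_bracket (t : bracket_index) y : R :=
  \big[Num.max/0]_q bracket_piece t q y.

Lemma card_bracket_index : #|bracket_index| = (T.+1 ^ (#|Q| * m ^ d))%N.
Proof. by rewrite card_ffun card_prod card_ffun !card_ord. Qed.

Lemma bracket_width_ge0 : 0 <= bracket_width.
Proof.
by rewrite mulr_ge0 ?scaled_peak_ge0// addr_ge0// ?mulr_ge0 ?invr_ge0 ?exprn_ge0//.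
Qed.

Lemma measurable_cube c : measurable (cube c).
Proof.
apply: (measurable_rV_box (A := fun i => [set z | `|z - c ord0 i| <= s * A])) => i.
rewrite (_ : [set _ | _] = `[c ord0 i - s * A, c ord0 i + s * A]%classic)//.
by apply/seteqP; split => z /=; rewrite in_itv/= ler_distl.
Qed.

Lemma lebesgue_cube c : lebesgue_rV R d (cube c) = ((2 * (s * A)) ^+ d)%:E.
Proof.
have sA : 0 <= s * A by rewrite mulr_ge0// ltW.
have E i : [set z | `|z - c ord0 i| <= s * A] = `[c ord0 i - s * A, c ord0 i + s * A]%classic.
  by apply/seteqP; split => z /=; rewrite in_itv/= ler_distl.
rewrite /cube (@lebesgue_rV_box _ _ (fun i => [set z | `|z - c ord0 i| <= s * A])).
  rewrite (eq_bigr (fun=> (2 * (s * A))%:E)); last first.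
    move=> i _; rewrite E lebesgue_measure_itv/= lte_fin.
    case: ltP => [_|h]; first by rewrite -EFinB; congr EFin; ring.
    by congr EFin; lra.
  by rewrite prodEFin prodr_const card_ord.
by move=> i; rewrite E.
Qed.

Lemma measurable_local_expansion c (M : {ffun 'I_d -> 'I_m} -> R) :
  measurable_fun setT (local_expansion c M).
Proof.
apply: measurable_funM => //; apply: measurable_sum => alpha.
apply: measurable_funM => //; apply: measurable_prod => i _.
have mi : measurable_fun [set: V] (fun y : V => (y ord0 i - c ord0 i) / s).
  apply: measurable_funM => //; apply: measurable_funB => //.
  exact: measurable_rV_coord.
exact: (measurableT_comp (measurable_gaussian_feature (alpha i)) mi).
Qed.

Lemma measurable_upper_bracket t : measurable_fun setT (upper_bracket t).
Proof.
rewrite /upper_bracket; elim: (index_enum Q) => [|q r IH].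
  by under eq_fun do rewrite big_nil; exact: measurable_cst.
under eq_fun do rewrite big_cons; apply: measurable_maxr => //.
apply: measurable_funM; first by apply: measurable_indic; exact: measurable_cube.
by apply: measurable_funD => //; exact: measurable_local_expansion.
Qed.

Lemma upper_bracket_ge0 t y : 0 <= upper_bracket t y.
Proof.
rewrite /upper_bracket; elim: (index_enum Q) => [|q r IH]; first by rewrite big_nil.
by rewrite big_cons le_max IH orbT.
Qed.

Definition cover : set V := [set y | exists q, cube (center q) y].

Lemma measurable_cover : measurable cover.
Proof.
rewrite (_ : cover = \bigcup_(q in [set: Q]) cube (center q)); last first.
  by apply/seteqP; split => [y [q cy]|y [q _ cy]]; exists q.
by apply: fin_bigcup_measurable => // q _; exact: measurable_cube.
Qed.

Lemma lebesgue_cover_le :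
  (lebesgue_rV R d cover <= (#|Q|%:R * (2 * (s * A)) ^+ d)%:E)%E.
Proof.
rewrite -[cover]setIT -integral_indic//; last exact: measurable_cover.
apply: (@le_trans _ _ (\int[lebesgue_rV R d]_y \sum_q (\1_(cube (center q)) y)%:E)%E).
  apply: ge0_le_integral => //.
  - by apply/measurable_EFinP/measurable_indic; exact: measurable_cover.
  - apply: emeasurable_sum => q; apply/measurable_EFinP/measurable_indic.
    exact: measurable_cube.
  - move=> y _; rewrite sumEFin lee_fin indicE.
    have [/set_mem[q cy]|_] := boolP (y \in cover); last by apply: sumr_ge0.
    by rewrite (bigD1 q)//= indicE mem_set//= lerDl; apply: sumr_ge0.
rewrite ge0_integral_sum//; last first.
  by move=> q; apply/measurable_EFinP/measurable_indic; exact: measurable_cube.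
rewrite mulr_natl -sumr_const -sumEFin; apply: lee_sum => q _.
rewrite integral_indic ?setIT//; last exact: measurable_cube.
by rewrite [leLHS]lebesgue_cube.
Qed.

(** Adding the width to the rounded expansion turns approximation up to the
    width into a bracket of twice the width. *)
Lemma mixture_bracketed G : exists t, forall y, cover y ->
  s ^- d * location_mixture G (s^-1 *: y) <= upper_bracket t y <=
  s ^- d * location_mixture G (s^-1 *: y) + 2 * bracket_width.
Proof.
pose M q alpha := feature_moment (m := m) G (center q) alpha.
have /choice[t tE] : forall qa : Q * {ffun 'I_d -> 'I_m}, exists t : 'I_T.+1,
    `|grid_point t - M qa.1 qa.2| <= 2 / T%:R.
  by move=> qa; apply: grid_rounding => //; exact: feature_moment_le1.
exists [ffun qa => t qa] => y [q0 yq0].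
set f := s ^- d * _.
have f0 : 0 <= f.
  by rewrite mulr_ge0 ?invr_ge0 ?exprn_ge0 ?(ltW s_gt0)// ltW// location_mixture_gt0.
have piece q : cube (center q) y ->
    f <= bracket_piece [ffun qa => t qa] q y <= f + 2 * bracket_width.
  move=> yq; rewrite /bracket_piece indicE mem_set// mul1r.
  set a := local_expansion _ _ _.
  have : `|f - local_expansion (center q) (M q) y| <=
      scaled_peak * (d%:R * (2 ^- m * expR (3 / 2 * A ^+ 2))).
    exact: local_expansion_error.
  have : `|local_expansion (center q) (M q) y - a| <=
      scaled_peak * ((m ^ d)%:R * (2 / T%:R)).
    rewrite /a /local_expansion -mulrBr normrM ger0_norm ?scaled_peak_ge0//.
    rewrite ler_wpM2l ?scaled_peak_ge0// -sumrB.
    apply: le_trans (ler_norm_sum _ _ _) _.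
    rewrite [leRHS](_ : _ = \sum_(alpha : {ffun 'I_d -> 'I_m}) 2 / T%:R); last first.
      by rewrite sumr_const card_ffun !card_ord mulr_natl.
    apply: ler_sum => alpha _; rewrite -mulrBl normrM ffunE distrC.
    apply: le_trans (tE (q, alpha)); rewrite ler_piMr//.
    exact: prod_feature_le1.
  rewrite !ler_norml /bracket_width mulrDr => /andP[h1 h2] /andP[h3 h4].
  apply/andP; split; lra.
apply/andP; split.
  have /andP[le_f _] := piece q0 yq0; apply: (le_trans le_f).
  rewrite /upper_bracket; have := mem_index_enum q0.
  elim: (index_enum Q) => // q r IH; rewrite inE big_cons le_max => /orP[/eqP <-|/IH->].
    by rewrite lexx.
  by rewrite orbT.
have b0 := bracket_width_ge0.
rewrite /upper_bracket; elim: (index_enum Q) => [|q r IH].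
  by rewrite big_nil addr_ge0// mulr_ge0.
rewrite big_cons ge_max IH andbT.
have [/set_mem yq|yq] := boolP (y \in cube (center q)).
  by have /andP[] := piece q yq.
by rewrite /bracket_piece indicE (negbTE yq) mul0r addr_ge0// mulr_ge0.
Qed.

End mixture_brackets.

(** * Tails of Gaussian mixtures and covering by cubes *)

Section gaussian_tail.
Variables (R : realType) (d : nat).
Local Notation V := 'rV[R]_d.

(** Up to the factor (sigma / s)^d, a Gaussian whose covariance lies between
    s^2 I and sigma^2 I is dominated by the isotropic one with variance
    sigma^2. *)
Lemma normal_density_le (mu y : V) (S : 'M[R]_d) (s sigma : R) :
  0 < s -> 0 < sigma -> posdefmx S -> s ^+ (2 * d) <= \det S ->
  (forall x : V, (x *m S *m x^T) 0 0 <= sigma ^+ 2 * sqnorm2 x) ->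
  normal_density mu S y <=
  s ^- d * (2 * pi) `^ (- (d%:R / 2)) * expR (- (sqnorm2 (y - mu) / (sigma ^+ 2 * 2))).
Proof.
move=> s0 sg0 pS dS qS.
have dS0 : 0 < \det S by apply: lt_le_trans dS; rewrite exprn_gt0.
rewrite /normal_density [s ^- d * _]mulrC.
apply: ler_pM; rewrite ?mulr_ge0 ?powR_ge0 ?expR_ge0//.
  rewrite ler_wpM2l ?powR_ge0// powRN powR12_sqrt ?(ltW dS0)// lef_pV2 ?posrE ?exprn_gt0 ?sqrtr_gt0//.
  rewrite -(@ler_pXn2r _ 2)// ?nnegrE ?sqrtr_ge0 ?exprn_ge0 ?(ltW s0)//.
  by rewrite sqr_sqrtr ?(ltW dS0)// -exprM mulnC.
rewrite ler_expR lerN2 invfM mulrA ler_wpM2r ?invr_ge0//.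
by apply: inv_quadratic_lower_bound => //; rewrite exprn_gt0.
Qed.

Lemma integral_gaussian_wide (mu : V) (sigma : R) : 0 < sigma ->
  (\int[lebesgue_rV R d]_y ((2 * pi) `^ (- (d%:R / 2)) *
     expR (- (sqnorm2 (y - mu) / (sigma ^+ 2 * 2) / 2)))%:E =
   ((Num.sqrt 2 * sigma) ^+ d)%:E)%E.
Proof.
move=> sg0; set r := Num.sqrt 2 * sigma.
have r0 : 0 < r by rewrite mulr_gt0 ?sqrtr_gt0.
have r2 : r ^+ 2 = 2 * sigma ^+ 2 by rewrite exprMn sqr_sqrtr.
rewrite -[RHS]mule1 -(integral_gaussian_rV mu r0) -ge0_integralZl//; last 3 first.
- apply/measurable_EFinP; apply: measurable_funM => //; apply: measurableT_comp => //.
  apply: measurableT_comp => //; apply: measurable_funM => //.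
  by apply: measurable_sqnorm2_comp; apply: measurable_rV_sub.
- by move=> y _; rewrite lee_fin !mulr_ge0 ?invr_ge0 ?exprn_ge0 ?powR_ge0 ?expR_ge0// ltW.
- by rewrite lee_fin exprn_ge0// ltW.
apply: eq_integral => y _; rewrite -EFinM; congr EFin.
rewrite r2 [in RHS]mulrA [in RHS]mulrA mulfV ?expf_neq0 ?gt_eqF// mul1r.
congr (_ * expR (- _)).
by field; exact: lt0r_neq0.
Qed.

(** Half of the exponent is spent on the distance to the means; the other half
    keeps the integral finite, at the price of widening sigma by sqrt 2. *)
Lemma gaussian_mixture_tail k (w : 'I_k -> R) (mu : 'I_k -> V)
    (Sg : 'I_k -> 'M[R]_d) (s sigma rho2 : R) (S : set V) :
  0 < s -> 0 < sigma -> (forall j, 0 <= w j) -> \sum_(j < k) w j = 1 ->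
  (forall j, posdefmx (Sg j)) -> (forall j, s ^+ (2 * d) <= \det (Sg j)) ->
  (forall j (x : V), (x *m Sg j *m x^T) 0 0 <= sigma ^+ 2 * sqnorm2 x) ->
  measurable S -> (forall y, ~ S y -> forall j, rho2 <= sqnorm2 (y - mu j)) ->
  (\int[lebesgue_rV R d]_(y in ~` S) (finite_normal_mixture w mu Sg y)%:E <=
   (s ^- d * (Num.sqrt 2 * sigma) ^+ d * expR (- (rho2 / (sigma ^+ 2 * 4))))%:E)%E.
Proof.
move=> s0 sg0 w0 w1 pS dS qS mS rhoS.
have sg2 : 0 < sigma ^+ 2 by rewrite exprn_gt0.
pose b j y := (2 * pi) `^ (- (d%:R / 2)) *
     expR (- (sqnorm2 (y - mu j) / (sigma ^+ 2 * 2) / 2)).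
have b0 j y : 0 <= b j y by rewrite mulr_ge0 ?powR_ge0 ?expR_ge0.
have mb j : measurable_fun setT (b j).
  apply: measurable_funM => //; apply: measurableT_comp => //.
  apply: measurableT_comp => //; apply: measurable_funM => //; apply: measurable_funM => //.
  by apply: measurable_sqnorm2_comp; apply: measurable_rV_sub.
set K := s ^- d * expR (- (rho2 / (sigma ^+ 2 * 4))).
have K0 : 0 <= K by rewrite mulr_ge0 ?expR_ge0// invr_ge0 exprn_ge0// ltW.
have Kw0 j : 0 <= K * w j by exact: mulr_ge0.
have Kwb0 j y : (0%R <= (K * w j * b j y)%:E)%E by rewrite lee_fin; exact: mulr_ge0.
apply: (@le_trans _ _ (\int[lebesgue_rV R d]_(y in ~` S) (\sum_(j < k) (K * w j * b j y)%:E))%E).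
  apply: ge0_le_integral => //.
  - exact: measurableC.
  - by move=> y _; rewrite lee_fin; apply: sumr_ge0 => j _; rewrite mulr_ge0// normal_density_ge0.
  - apply/measurable_funTS/measurable_EFinP; apply: measurable_sum => j.
    by apply: measurable_funM => //; apply: measurable_normal_density_comp.
  - apply/measurable_funTS; apply: emeasurable_sum => j.
    by apply/measurable_EFinP; apply: measurable_funM.
  - move=> y Sy; rewrite sumEFin lee_fin; apply: ler_sum => j _.
    have -> : K * w j * b j y = w j * (K * b j y) by ring.
    rewrite ler_wpM2l//; apply: le_trans (normal_density_le _ _ s0 sg0 (pS j) (dS j) (qS j)) _.
    have -> : K * b j y = s ^- d * (2 * pi) `^ (- (d%:R / 2)) *
        expR (- (rho2 / (sigma ^+ 2 * 4)) + - (sqnorm2 (y - mu j) / (sigma ^+ 2 * 2) / 2)).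
      by rewrite expRD /K /b; ring.
    rewrite ler_wpM2l ?mulr_ge0 ?powR_ge0 ?invr_ge0 ?exprn_ge0 ?(ltW s0)// ler_expR.
    have := rhoS y Sy j; set N := sqnorm2 _ => rN.
    have : rho2 / (sigma ^+ 2 * 4) <= N / (sigma ^+ 2 * 4).
      by rewrite ler_wpM2r// invr_ge0 mulr_ge0// ltW.
    have -> : N / (sigma ^+ 2 * 4) = N / (sigma ^+ 2 * 2) / 2.
      by field; exact: lt0r_neq0.
    lra.
rewrite ge0_integral_sum//; last 2 first.
- exact: measurableC.
- move=> j; apply/measurable_funTS/measurable_EFinP; apply: measurable_funM => //.
have -> : s ^- d * (Num.sqrt 2 * sigma) ^+ d * expR (- (rho2 / (sigma ^+ 2 * 4))) =
    \sum_(j < k) K * w j * (Num.sqrt 2 * sigma) ^+ d.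
  by rewrite -mulr_suml -mulr_sumr w1 /K mulr1 mulrAC.
rewrite -sumEFin.
apply: lee_sum => j _.
apply: (@le_trans _ _ (\int[lebesgue_rV R d]_y (K * w j * b j y)%:E)%E).
  apply: ge0_subset_integral => //; first exact: measurableC.
  by apply/measurable_EFinP; apply: measurable_funM.
under eq_integral do rewrite EFinM.
rewrite ge0_integralZl//; last 3 first.
- exact/measurable_EFinP.
- by move=> y _; rewrite lee_fin.
- by rewrite lee_fin.
by rewrite integral_gaussian_wide// -EFinM.
Qed.

End gaussian_tail.

Section cube_cover.
Variables (R : realType) (d k : nat) (s A : R) (L : nat).
Hypotheses (s_gt0 : 0 < s) (A_gt0 : 0 < A) (L_gt0 : (0 < L)%N).
Local Notation V := 'rV[R]_d.
Variable mu : 'I_k -> V.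

Definition box_center (q : 'I_k * {ffun 'I_d -> 'I_L}) : V :=
  \row_i (mu q.1 ord0 i + s * A * (2 * (q.2 i)%:R + 1 - L%:R)).

(** The last index is used for the right end point, which belongs to no
    half-open interval of the subdivision. *)
Lemma interval_subdivision (z : R) : `|z| <= L%:R * (s * A) ->
  exists p : 'I_L, `|z - s * A * (2 * p%:R + 1 - L%:R)| <= s * A.
Proof.
move=> zL; have a0 : 0 < s * A by rewrite mulr_gt0.
set a := s * A in zL a0 *; move: zL; rewrite ler_norml => /andP[z1 z2].
have L0 : 0 < L%:R :> R by rewrite ltr0n.
pose x := (z / a + L%:R) / 2.
have za : z = a * (2 * x - L%:R) by rewrite /x; field; exact: lt0r_neq0.
have x0 : 0 <= x.
  rewrite divr_ge0// -lerBlDr sub0r ler_pdivlMr// mulNr -mulNr.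
  by rewrite mulNr.
have xL : x <= L%:R.
  by rewrite /x ler_pdivrMr// mulr_natr mulr2n lerD2r ler_pdivrMr.
have [xlt|xge] := ltP x L%:R.
  have /andP[x1 x2] := Num.Theory.truncn_itv x0.
  have tL : (Num.truncn x < L)%N by rewrite -(ltr_nat R); apply: le_lt_trans xlt.
  exists (Ordinal tL) => /=.
  move: x2; rewrite -natr1 => x2.
  have -> : z - a * (2 * (Num.truncn x)%:R + 1 - L%:R) = a * (2 * (x - (Num.truncn x)%:R) - 1).
    by rewrite {1}za; ring.
  rewrite normrM gtr0_norm// ler_piMr ?(ltW a0)// ler_norml.
  by apply/andP; split; lra.
have xE : x = L%:R by apply/eqP; rewrite eq_le xL.
have pL : (L.-1 < L)%N by rewrite prednK.
exists (Ordinal pL) => /=.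
have -> : L.-1%:R = L%:R - 1 :> R by rewrite -{2}(prednK L_gt0) -natr1 addrK.
rewrite za xE (_ : _ - _ = a); last by ring.
by rewrite gtr0_norm.
Qed.

Lemma box_subset_cover (y : V) j :
  (forall i, `|y ord0 i - mu j ord0 i| <= L%:R * (s * A)) -> cover s A box_center y.
Proof.
move=> h; have [p pE] := choice (fun i => interval_subdivision (h i)).
exists (j, [ffun i => p i]) => i; rewrite mxE ffunE/= opprD addrA.
exact: pE.
Qed.

End cube_cover.

(** * Choice of the parameters *)

Section rate_constants.
Variables (R : realType) (d : nat).

(** The truncation order is a multiple of the binary logarithm of n rounded
    up, which is at most 2 / log 2 times log n. *)
Definition log_ratio : R := 2 / ln 2.
Definition entropy_constant : R :=
  (6 * ((d + 5)%:R * log_ratio)) ^+ d *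
  ((2 * d + 4)%:R + d%:R * ln (d + 5)%:R / ln 2).
Definition remainder_constant : R :=
  2 * 2 ^+ d + 2 * 12 ^+ d * (d + 2)%:R + 3.
(** The remainder constant collects the terms of order 1/n, which are compared
    with the rate through log n >= log 2. *)
Definition rate_constant : R :=
  remainder_constant / ln 2 ^+ d.+1 + 2 * entropy_constant.

Lemma ln2_gt0 : 0 < ln 2 :> R.
Proof. by rewrite ln_gt0// ltr1n. Qed.

Lemma remainder_constant_ge2 : 2 <= remainder_constant.
Proof.
have h1 : 0 <= 2 * 2 ^+ d :> R by rewrite mulr_ge0// exprn_ge0.
have h2 : 0 <= 2 * 12 ^+ d * (d + 2)%:R :> R by rewrite !mulr_ge0// exprn_ge0.
rewrite /remainder_constant; lra.
Qed.

Lemma entropy_constant_ge0 : 0 <= entropy_constant.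
Proof.
have l0 := ln2_gt0.
have lr0 : 0 <= log_ratio by rewrite divr_ge0// ltW.
have ld5 : 0 <= ln (d + 5)%:R :> R by rewrite ln_ge0// ler1n addn_gt0 orbT.
apply: mulr_ge0; first by apply: exprn_ge0; apply: mulr_ge0 => //; apply: mulr_ge0.
apply: addr_ge0 => //; apply: divr_ge0; last exact: ltW.
exact: mulr_ge0.
Qed.

Lemma rate_constant_gt0 : 0 < rate_constant.
Proof.
have := remainder_constant_ge2; have := entropy_constant_ge0 => e0 r2.
apply: ltr_pwDl; last exact: mulr_ge0.
by apply: divr_gt0; [exact: lt_le_trans r2|exact/exprn_gt0/ln2_gt0].
Qed.

Variable n : nat.
Hypothesis n_ge2 : (2 <= n)%N.
Let lg : R := ln n%:R.

Lemma ln2_le_ln : ln 2 <= lg.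
Proof. by rewrite ler_ln ?posrE ?ltr0n ?ler_nat// (leq_trans _ n_ge2). Qed.

Let n_gt0 : 0 < n%:R :> R.
Proof. by rewrite ltr0n (leq_trans _ n_ge2). Qed.

Let lg_gt0 : 0 < lg.
Proof. exact: lt_le_trans ln2_gt0 ln2_le_ln. Qed.

Lemma ln_le_self : lg <= n%:R.
Proof. by have := expR_ge1Dx lg; rewrite lnK ?posrE//; lra. Qed.

Lemma up_log2_le_ln : (up_log 2 n)%:R <= log_ratio * lg.
Proof.
have /andP[lt_n _] := up_log_bounds (isT : (1 < 2)%N) n_ge2.
have u0 : (0 < up_log 2 n)%N by rewrite up_log_gt0.
rewrite /log_ratio mulrAC ler_pdivlMr ?ln2_gt0//.
have : ln ((2 ^ (up_log 2 n).-1)%N%:R) <= lg.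
  by rewrite ler_ln ?posrE ?ltr0n ?expn_gt0// ?(leq_trans _ n_ge2)// ler_nat ltnW.
have -> : (up_log 2 n)%:R = (up_log 2 n).-1%:R + 1 :> R by rewrite natr1 prednK.
rewrite natrX lnXn// -[X in X <= lg -> _]mulr_natl.
by have := ln2_le_ln; lra.
Qed.

Lemma up_log2_le : (up_log 2 n <= n)%N.
Proof. by apply: up_log_min => //; exact/ltnW/ltn_expl. Qed.

Let m := ((d + 5) * up_log 2 n)%N.
Let T := (n ^ (d + 3) * m ^ d)%N.

Let m_gt0 : (0 < m)%N.
Proof. by rewrite muln_gt0 addn_gt0 orbT up_log_gt0. Qed.

Let T_gt0 : (0 < T)%N.
Proof. by rewrite muln_gt0 !expn_gt0 m_gt0 (leq_trans _ n_ge2). Qed.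

(** The choices m = (d + 5) up_log 2 n and T = n^(d+3) m^d make both errors of
    order n^-(d+3): 2^-m <= n^-(d+5) absorbs exp (3/2 log n) <= n^2, and the
    grid step 2 / T is shared by the m^d coefficients.  This order beats the
    factor n^(d+2) coming from the sample size and the volume of the cover. *)
Lemma discretization_error_le :
  d%:R * (2 ^- m * expR (3 / 2 * lg)) + (m ^ d)%:R * (2 / T%:R) <=
  (d + 2)%:R / n%:R ^+ (d + 3) :> R.
Proof.
have -> : (d + 2)%:R / n%:R ^+ (d + 3) = d%:R / n%:R ^+ (d + 3) + 2 / n%:R ^+ (d + 3) :> R.
  by rewrite -mulrDl natrD.
apply: lerD.
  rewrite ler_wpM2l//.
  have h1 : 2 ^- m <= n%:R ^- (d + 5) :> R.
    rewrite lef_pV2 ?posrE ?exprn_gt0// /m mulnC exprM lerXn2r ?nnegrE ?exprn_ge0//.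
    by rewrite -natrX ler_nat; have /andP[] := up_log_bounds (isT : (1 < 2)%N) n_ge2.
  have h2 : expR (3 / 2 * lg) <= n%:R ^+ 2.
    have -> : n%:R ^+ 2 = expR (2 * lg) :> R by rewrite expRM_natl lnK.
    by rewrite ler_expR ler_wpM2r ?(ltW lg_gt0)//; lra.
  apply: (@le_trans _ _ (n%:R ^- (d + 5) * n%:R ^+ 2)).
    by apply: ler_pM; rewrite ?invr_ge0 ?exprn_ge0 ?expR_ge0.
  rewrite -[(d + 5)%N]/(d + (3 + 2))%N addnA exprD invfM -mulrA mulVf ?mulr1//.
  by rewrite expf_neq0// gt_eqF.
rewrite /T natrM !natrX invfM mulrCA [X in _ * X]mulrCA mulfV ?mulr1//.
by rewrite expf_neq0// pnatr_eq0 -lt0n.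
Qed.

(** The grid size T is polynomial in n, so its logarithm is of order log n. *)
Lemma grid_entropy_le : ln T.+1%:R <=
  ((2 * d + 4)%:R + d%:R * ln (d + 5)%:R / ln 2) * lg :> R.
Proof.
have l2 := ln2_gt0; have ll := ln2_le_ln.
have d5 : 0 < (d + 5)%:R :> R by rewrite ltr0n addn_gt0 orbT.
have ld5 : 0 <= ln (d + 5)%:R :> R by rewrite ln_ge0// ler1n addn_gt0 orbT.
have TT : (T.+1 <= 2 * (n ^ (d + 3) * ((d + 5) * n) ^ d))%N.
  apply: (@leq_trans (2 * T)); first by rewrite mul2n -addnn -addn1 leq_add2l.
  rewrite leq_mul2l/= leq_mul2l; apply/orP; right.
  have [->|d0] := posnP d; first by rewrite !expn0.
  by rewrite leq_exp2r// leq_mul2l up_log2_le orbT.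
apply: (@le_trans _ _ (ln ((2 * (n ^ (d + 3) * ((d + 5) * n) ^ d))%N%:R))).
  by rewrite ler_ln ?posrE ?ltr0n ?ler_nat// (leq_trans _ TT).
rewrite !natrM !natrX natrM lnM ?posrE ?mulr_gt0 ?exprn_gt0 ?mulr_gt0//.
rewrite lnM ?posrE ?mulr_gt0 ?exprn_gt0 ?mulr_gt0//.
rewrite !lnXn ?mulr_gt0// lnM ?posrE// -/lg.
rewrite -[lg *+ _]mulr_natl -[(_ + lg) *+ _]mulr_natl.
have : ln (d + 5)%:R <= ln (d + 5)%:R / ln 2 * lg :> R.
  by rewrite mulrAC ler_pdivlMr// ler_wpM2l.
move=> /(ler_wpM2l (ler0n R d)).
have -> : (2 * d + 4)%:R = 2 * d%:R + 4 :> R by rewrite natrD natrM.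
have -> : (d + 3)%:R = d%:R + 3 :> R by rewrite natrD.
rewrite -[d%:R * ln _ / _]mulrA; set l5 := ln (d + 5)%:R; set q := l5 / ln 2.
lra.
Qed.

End rate_constants.

Section rate_arithmetic.
Variables (R : realType) (d n k : nat) (s sigma t1 : R).
Hypotheses (n_ge2 : (2 <= n)%N) (k_gt0 : (0 < k)%N) (s_gt0 : 0 < s) (sigma_gt0 : 0 < sigma).
Hypotheses (t1_ge1 : 1 <= t1) (sigma_le : sigma / s <= Num.sqrt 2 * t1).
Hypothesis small_k : k%:R * t1 ^+ d <= n%:R.
Let lg : R := ln n%:R.
Let A := Num.sqrt lg.
Let L := (Num.truncn (5 * t1)).+1.
Let m := ((d + 5) * up_log 2 n)%N.
Let T := (n ^ (d + 3) * m ^ d)%N.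
Let width := bracket_width d s A m T.
Let cells := (k * L ^ d)%N.

Let n_gt0 : 0 < n%:R :> R.
Proof. by rewrite ltr0n (leq_trans _ n_ge2). Qed.

Let lg_gt0 : 0 < lg.
Proof. exact: lt_le_trans (ln2_gt0 R) (ln2_le_ln R n_ge2). Qed.

Let A2 : A ^+ 2 = lg. Proof. by rewrite sqr_sqrtr// ltW. Qed.

Let t1_ge0 : 0 <= t1. Proof. exact: le_trans t1_ge1. Qed.

Lemma cells_per_side_le : L%:R <= 6 * t1.
Proof.
have t5 : 0 <= 5 * t1 by rewrite mulr_ge0.
have /andP[h _] := Num.Theory.truncn_itv t5.
have -> : L%:R = (Num.truncn (5 * t1))%:R + 1 :> R by rewrite natr1.
by move: t1_ge1; lra.
Qed.

(** With more than 5 max(1, tau) cubes per side the boxes reach the distance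
    sigma sqrt (12 log n), because sigma / s <= sqrt 2 max(1, tau) and
    24 <= 25. *)
Lemma cells_cover_tail : 12 * sigma ^+ 2 * lg <= (L%:R * (s * A)) ^+ 2.
Proof.
have t5 : 0 <= 5 * t1 by rewrite mulr_ge0.
have /andP[_ h] := Num.Theory.truncn_itv t5.
have L5 : 5 * t1 <= L%:R by exact: ltW.
have sg : sigma <= Num.sqrt 2 * t1 * s by rewrite -ler_pdivrMr.
have sg2 : sigma ^+ 2 <= 2 * (t1 * s) ^+ 2.
  have -> : 2 * (t1 * s) ^+ 2 = (Num.sqrt 2 * t1 * s) ^+ 2.
    by rewrite -mulrA [RHS]exprMn sqr_sqrtr.
  by rewrite lerXn2r ?nnegrE ?(ltW sigma_gt0) ?mulr_ge0 ?sqrtr_ge0 ?(ltW s_gt0).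
rewrite !exprMn A2 mulrA; apply: ler_wpM2r; first exact: ltW.
have L25 : (5 * t1) ^+ 2 <= L%:R ^+ 2 by rewrite lerXn2r ?nnegrE.
have : (5 * t1) ^+ 2 * s ^+ 2 <= L%:R ^+ 2 * s ^+ 2.
  by rewrite ler_wpM2r// exprn_ge0// ltW.
have : 0 <= (t1 * s) ^+ 2 by rewrite sqr_ge0.
move: sg2; rewrite !exprMn; lra.
Qed.

Lemma cells_le : cells%:R <= 6 ^+ d * (k%:R * t1 ^+ d) :> R.
Proof.
rewrite /cells natrM natrX mulrCA ler_wpM2l// -exprMn lerXn2r ?nnegrE ?mulr_ge0//.
exact: cells_per_side_le.
Qed.

(** The distance sigma sqrt (12 log n) makes the exponential factor n^-3; one
    power of n is lost to (sigma / s)^d and one to the union bound over the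
    sample. *)
Lemma tail_term_le : n%:R * (s ^- d * (Num.sqrt 2 * sigma) ^+ d *
    expR (- (12 * sigma ^+ 2 * lg / (sigma ^+ 2 * 4)))) <= 2 ^+ d / n%:R.
Proof.
have -> : 12 * sigma ^+ 2 * lg / (sigma ^+ 2 * 4) = 3 * lg by field; exact: lt0r_neq0.
rewrite expRN expRM_natl lnK ?posrE//.
have -> : s ^- d * (Num.sqrt 2 * sigma) ^+ d = (Num.sqrt 2 * (sigma / s)) ^+ d.
  by rewrite -exprVn -exprMn; congr (_ ^+ _); ring.
have h : (Num.sqrt 2 * (sigma / s)) ^+ d <= 2 ^+ d * n%:R.
  apply: (@le_trans _ _ ((2 * t1) ^+ d)).
    rewrite lerXn2r ?nnegrE ?mulr_ge0 ?sqrtr_ge0 ?invr_ge0 ?(ltW s_gt0) ?(ltW sigma_gt0)//.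
    apply: le_trans (ler_wpM2l (sqrtr_ge0 2) sigma_le) _.
    by rewrite mulrA -expr2 sqr_sqrtr.
  rewrite exprMn ler_wpM2l ?exprn_ge0//; apply: le_trans small_k.
  by rewrite ler_peMl ?exprn_ge0// ler1n.
apply: (@le_trans _ _ (n%:R * (2 ^+ d * n%:R * n%:R ^- 3))).
  by rewrite ler_wpM2l// ler_wpM2r// invr_ge0 exprn_ge0.
have -> : n%:R * (2 ^+ d * n%:R * n%:R ^- 3) = 2 ^+ d / n%:R :> R by field; exact: lt0r_neq0.
exact: lexx.
Qed.

(** The powers of s in the height of a Gaussian and in the volume of a cube
    cancel. *)
Lemma bracket_term_le :
  n%:R * (2 * width) * (cells%:R * (2 * (s * A)) ^+ d) <=
  2 * 12 ^+ d * (d + 2)%:R / n%:R.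
Proof.
set W := d%:R * (2 ^- m * expR (3 / 2 * lg)) + (m ^ d)%:R * (2 / T%:R).
have W0 : 0 <= W.
  by rewrite addr_ge0// !mulr_ge0 ?invr_ge0 ?exprn_ge0 ?expR_ge0.
have WW : W <= (d + 2)%:R / n%:R ^+ (d + 3) by exact: discretization_error_le.
have -> : width = s ^- d * (2 * pi) `^ (- (d%:R / 2)) * W.
  by rewrite /width /bracket_width A2.
have kap : (2 * pi) `^ (- (d%:R / 2)) <= 1 :> R.
  rewrite -[leRHS](powRr0 (2 * pi)); apply: ler_powR; last by rewrite oppr_le0 divr_ge0.
  by have := @pi_ge2 R; lra.
have An : A <= n%:R.
  rewrite -(@ler_pXn2r _ 2)// ?nnegrE ?sqrtr_ge0// A2.
  apply: le_trans (ln_le_self R n_ge2) _.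
  by rewrite expr2 ler_peMl// ler1n (leq_trans _ n_ge2).
have cn : cells%:R <= 6 ^+ d * n%:R :> R.
  by apply: le_trans cells_le _; rewrite ler_wpM2l ?exprn_ge0.
rewrite !exprMn.
have -> : n%:R * (2 * (s ^- d * (2 * pi) `^ (- (d%:R / 2)) * W)) *
    (cells%:R * (2 ^+ d * (s ^+ d * A ^+ d))) =
  (2 * n%:R * 2 ^+ d) * ((2 * pi) `^ (- (d%:R / 2)) * (W * (cells%:R * A ^+ d))).
  field; rewrite expf_neq0// gt_eqF//.
have -> : 2 * 12 ^+ d * (d + 2)%:R / n%:R =
    (2 * n%:R * 2 ^+ d) * (1 * ((d + 2)%:R / n%:R ^+ (d + 3) * (6 ^+ d * n%:R * n%:R ^+ d))) :> R.
  have -> : 12 = 2 * 6 :> R by lra.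
  rewrite exprMn exprD; field.
  by rewrite expf_neq0 ?gt_eqF.
have A0 : 0 <= A by exact: sqrtr_ge0.
apply: ler_wpM2l; first by rewrite !mulr_ge0 ?exprn_ge0// ltW.
apply: ler_pM => //; [exact: powR_ge0|by rewrite !mulr_ge0 ?exprn_ge0|].
apply: ler_pM => //; first by rewrite mulr_ge0 ?exprn_ge0.
apply: ler_pM => //; first by rewrite exprn_ge0.
by rewrite lerXn2r ?nnegrE// ltW.
Qed.

Lemma entropy_term_le : ln ((T.+1 ^ (cells * m ^ d))%N)%:R <=
  entropy_constant R d * (k%:R * t1 ^+ d) * lg ^+ d.+1.
Proof.
have l0 := ln2_gt0 R.
rewrite natrX lnXn// -[leLHS]mulr_natl natrM natrX.
pose K : R := (2 * d + 4)%:R + d%:R * ln (d + 5)%:R / ln 2.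
have hT : ln T.+1%:R <= K * lg by exact: grid_entropy_le.
have T0 : 0 <= ln T.+1%:R :> R by rewrite ln_ge0// ler1n.
have hm : m%:R <= (d + 5)%:R * log_ratio R * lg.
  by rewrite /m natrM -mulrA ler_wpM2l// up_log2_le_ln.
have lr0 : 0 <= log_ratio R by rewrite divr_ge0// ltW.
have -> : entropy_constant R d * (k%:R * t1 ^+ d) * lg ^+ d.+1 =
    6 ^+ d * (k%:R * t1 ^+ d) * ((d + 5)%:R * log_ratio R * lg) ^+ d * (K * lg).
  by rewrite /entropy_constant -/K !exprMn exprSr; ring.
apply: ler_pM => //; apply: ler_pM => //; first exact: cells_le.
by rewrite lerXn2r ?nnegrE//; apply: le_trans hm.
Qed.

Lemma total_rate_le :
  2 * (n%:R * (s ^- d * (Num.sqrt 2 * sigma) ^+ d *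
    expR (- (12 * sigma ^+ 2 * lg / (sigma ^+ 2 * 4))))) +
  (n%:R * (2 * width) * (cells%:R * (2 * (s * A)) ^+ d) + n%:R^-1) +
  2 / n%:R * (ln ((T.+1 ^ (cells * m ^ d))%N)%:R + 1) <=
  rate_constant R d * (k%:R / n%:R) * t1 ^+ d * lg ^+ d.+1.
Proof.
have h1 := tail_term_le; have h2 := bracket_term_le; have h3 := entropy_term_le.
have l0 := ln2_gt0 R.
have ni : 0 <= n%:R^-1 :> R by rewrite invr_ge0 ltW.
have {}h3 : 2 / n%:R * ln ((T.+1 ^ (cells * m ^ d))%N)%:R <=
    2 / n%:R * (entropy_constant R d * (k%:R * t1 ^+ d) * lg ^+ d.+1).
  by rewrite ler_wpM2l// mulr_ge0.
have h4 : remainder_constant R d / n%:R <=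
    remainder_constant R d / n%:R * (k%:R * t1 ^+ d * (lg / ln 2) ^+ d.+1).
  rewrite ler_peMr//; first by rewrite divr_ge0 ?(ltW n_gt0)// (le_trans _ (remainder_constant_ge2 R d)).
  rewrite -mulrA mulr_ege1 ?ler1n//.
  by rewrite mulr_ege1 ?exprn_ege1// ler_pdivlMr// mul1r ln2_le_ln.
have -> : rate_constant R d * (k%:R / n%:R) * t1 ^+ d * lg ^+ d.+1 =
   remainder_constant R d / n%:R * (k%:R * t1 ^+ d * (lg / ln 2) ^+ d.+1) +
   2 / n%:R * (entropy_constant R d * (k%:R * t1 ^+ d) * lg ^+ d.+1).
  rewrite /rate_constant expr_div_n; field.
  by rewrite expf_neq0 ?gt_eqF.
move: h4; rewrite {1}/remainder_constant; lra.
Qed.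

End rate_arithmetic.

(** 2 is the largest possible squared Hellinger distance, so the risk bound is
    trivial in this range. *)
Lemma trivial_rate_ge2 (R : realType) (d n k : nat) (t1 : R) : (2 <= n)%N ->
  n%:R < k%:R * t1 ^+ d ->
  2 <= rate_constant R d * (k%:R / n%:R) * t1 ^+ d * ln n%:R ^+ d.+1.
Proof.
move=> n2 big.
have n0 : 0 < n%:R :> R by rewrite ltr0n (leq_trans _ n2).
have l0 := ln2_gt0 R; have ll := ln2_le_ln R n2.
have -> : rate_constant R d * (k%:R / n%:R) * t1 ^+ d * ln n%:R ^+ d.+1 =
    (rate_constant R d * ln n%:R ^+ d.+1) * (k%:R * t1 ^+ d / n%:R) by ring.
rewrite -[leLHS]mulr1; apply: ler_pM => //; last by rewrite ler_pdivlMr// mul1r ltW.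
apply: (@le_trans _ _ (remainder_constant R d / ln 2 ^+ d.+1 * ln 2 ^+ d.+1)).
  by rewrite divfK ?expf_neq0 ?gt_eqF// remainder_constant_ge2.
have rc := le_trans (ler0n R 2) (remainder_constant_ge2 R d).
apply: ler_pM.
- by rewrite divr_ge0 ?exprn_ge0// ltW.
- by rewrite exprn_ge0// ltW.
- by rewrite lerDl mulr_ge0// entropy_constant_ge0.
- by rewrite lerXn2r ?nnegrE ?(ltW l0)// (le_trans (ltW l0)).
Qed.

(** * The risk bound *)

Section npmle.
Variables (R : realType) (d n : nat).
Local Notation V := 'rV[R]_d.

Lemma npmle_likelihood (X : 'I_n -> V) (f g : V -> R) : (0 < n)%N ->
  is_npmle X f -> location_mixtures g ->
  \prod_(i < n) g (X i) <= \prod_(i < n) f (X i).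
Proof.
move=> n0 [[F ->] best] gM; have := best _ gM; case: gM => G ->.
have n0' : 0 < n%:R^-1 :> R by rewrite invr_gt0 ltr0n.
rewrite /mean_loglik ler_pM2l// => best'.
have prodE (H : probability V R) : \prod_(i < n) location_mixture H (X i) =
    expR (\sum_(i < n) ln (location_mixture H (X i))).
  rewrite expR_sum; apply: eq_bigr => i _.
  by rewrite lnK// posrE location_mixture_gt0.
by rewrite !prodE ler_expR.
Qed.

Lemma measurable_scaled_location_mixture (s : R) (h : V -> R) :
  scaled_location_mixture s h -> measurable_fun setT h.
Proof.
move=> [G hE]; rewrite (_ : h = fun y => s ^- d * location_mixture G (s^-1 *: y)).
  apply: measurable_funM => //.
  apply: (measurableT_comp (measurable_location_mixture G)).
  exact: measurable_rV_scale.
by apply/funext => y; exact: hE.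
Qed.

Lemma scaled_location_mixture_gt0 (s : R) (h : V -> R) y : 0 < s ->
  scaled_location_mixture s h -> 0 < h y.
Proof.
move=> s0 [G ->]; rewrite mulr_gt0 ?invr_gt0 ?exprn_gt0//.
exact: location_mixture_gt0.
Qed.

Lemma scaled_location_mixture_integral1 (s : R) (h : V -> R) : 0 < s ->
  scaled_location_mixture s h -> (\int[lebesgue_rV R d]_y (h y)%:E = 1)%E.
Proof.
move=> s0 [G hE]; rewrite -(integral_scaled_location_mixture G s0).
by apply: eq_integral => y _; rewrite hE.
Qed.

End npmle.

Theorem theorem2p5 (R : realType) (d : nat) (hd : (1 <= d)%N) :
  exists C : R, 0 < C /\
  forall (n k : nat), (2 <= n)%N -> (1 <= k)%N ->
  forall (mu : 'I_k -> 'rV[R]_d) (Sigma : 'I_k -> 'M[R]_d) (w : 'I_k -> R),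
  (forall j, posdefmx (Sigma j)) ->
  (forall j, 0 <= w j) -> \sum_(j < k) w j = 1 ->
  forall (sigma_min sigma_max : R), 0 < sigma_min -> 0 < sigma_max ->
  (forall j, sigma_min ^+ 2 <= lambda_min (Sigma j)) ->
  (forall j, lambda_max (Sigma j) <= sigma_max ^+ 2) ->
  let hstar := finite_normal_mixture w mu Sigma in
  forall (dO : measure_display) (Omega : measurableType dO)
    (P : probability Omega R) (Y : 'I_n -> {RV P >-> 'rV[R]_d}),
  mutually_independent Y ->
  (forall i, has_density (Y i) hstar) ->
  forall fhat : Omega -> 'rV[R]_d -> R,
  (forall omega, is_npmle (fun i => sigma_min^-1 *: Y i omega) (fhat omega)) ->
  let hhat omega x := sigma_min ^- d * fhat omega (sigma_min^-1 *: x) in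
  let tau := Num.sqrt (sigma_max ^+ 2 / sigma_min ^+ 2 - 1) in
  (\int[P]_omega sq_hellinger (hhat omega) hstar <=
    (C * (k%:R / n%:R) * Num.max 1 tau ^+ d * ln n%:R ^+ d.+1)%:E)%E.
Proof.
exists (rate_constant R d); split; first exact: rate_constant_gt0.
move=> n k n2 k1 mu Sigma w pS w0 w1 s sigma s0 sigma0 Smin Smax hstar.
move=> dO Omega P Y indep dens fhat npmle.
pose hhat omega (x : 'rV[R]_d) := s ^- d * fhat omega (s^-1 *: x).
pose tau := Num.sqrt (sigma ^+ 2 / s ^+ 2 - 1); pose t1 := Num.max 1 tau.
suff: (\int[P]_omega sq_hellinger (hhat omega) hstar <=
    (rate_constant R d * (k%:R / n%:R) * t1 ^+ d * ln n%:R ^+ d.+1)%:E)%E by [].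
have n0 : (0 < n)%N by exact: leq_trans n2.
have gaussians j := scaled_location_mixture_gaussian s0 (pS j) (Smin j).
have dS j : s ^+ (2 * d) <= \det (Sigma j) by exact: (gaussians j).1.
have qS j := lambda_max_quadratic (pS j) (Smax j).
have hmix : scaled_location_mixture s hstar.
  by apply: scaled_location_mixture_convex => // j; exact: (gaussians j).2.
have fmix omega : scaled_location_mixture s (hhat omega).
  by have [[G fG] _] := npmle omega; exists G => y; rewrite /hhat fG.
have mh := measurable_scaled_location_mixture hmix.
have mf omega := measurable_scaled_location_mixture (fmix omega).
have h_gt0 y : 0 < hstar y := scaled_location_mixture_gt0 y s0 hmix.
have f_gt0 omega y : 0 < hhat omega y := scaled_location_mixture_gt0 y s0 (fmix omega).
have h1 := scaled_location_mixture_integral1 s0 hmix.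
have f1 omega := scaled_location_mixture_integral1 s0 (fmix omega).
have t1_ge1 : 1 <= t1 by rewrite le_max lexx.
have sigma_t1 : sigma / s <= Num.sqrt 2 * t1.
  rewrite -(@ler_pXn2r _ 2)// ?nnegrE ?mulr_ge0 ?sqrtr_ge0 ?invr_ge0
    ?(ltW s0) ?(ltW sigma0) ?(le_trans ler01 t1_ge1)//.
  rewrite exprMn exprVn exprMn sqr_sqrtr//.
  have t12 : 1 <= t1 ^+ 2 by rewrite exprn_ege1.
  (* A negative argument of the square root makes tau = 0, while then
     sigma < s. *)
  have [r0|r0] := leP 0 (sigma ^+ 2 / s ^+ 2 - 1); last by lra.
  have : tau ^+ 2 <= t1 ^+ 2.
    by rewrite lerXn2r ?nnegrE ?sqrtr_ge0 ?(le_trans ler01 t1_ge1)// le_max lexx orbT.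
  by rewrite sqr_sqrtr//; lra.
have [small|big] := leP (k%:R * t1 ^+ d) n%:R; last first.
  apply: (@le_trans _ _ 2%:E); last by rewrite lee_fin trivial_rate_ge2.
  apply: (@le_trans _ _ (\int[P]_omega 2%:E)%E).
    apply: le_lower_integral => omega; apply/andP; split.
      by apply: integral_ge0 => x _; rewrite lee_fin sqr_ge0.
    by apply: hellinger_le2 => // y; exact: ltW.
  by rewrite integral_cst// [X in (_ * X)%E]probability_setT mule1.
set lg := ln n%:R; pose A := Num.sqrt lg; pose L := (Num.truncn (5 * t1)).+1.
pose m := ((d + 5) * up_log 2 n)%N; pose T := (n ^ (d + 3) * m ^ d)%N.
have lg0 : 0 < lg by apply: lt_le_trans (ln2_le_ln R n2); exact: ln2_gt0.
have A0 : 0 < A by rewrite sqrtr_gt0.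
have T0 : (0 < T)%N.
  by rewrite muln_gt0 !expn_gt0 muln_gt0 addn_gt0 orbT up_log_gt0 n2 n0.
have L0 : (0 < L)%N by [].
pose center := @box_center R d k s A L mu.
pose S := cover s A center.
have mS : measurable S by exact: measurable_cover.
have tailS y : ~ S y -> forall j, 12 * sigma ^+ 2 * lg <= sqnorm2 (y - mu j).
  move=> Sy j; apply: (le_trans (cells_cover_tail n2 s0 sigma0 t1_ge1 sigma_t1)).
  have [i yi] : exists i, ~ (`|y ord0 i - mu j ord0 i| <= L%:R * (s * A)).
    by apply/existsNP => h; apply: Sy; exact: box_subset_cover h.
  move/negP: yi; rewrite -ltNge => yi.
  rewrite /sqnorm2 (bigD1 i)//= -[leLHS]addr0; apply: lerD.
    rewrite !mxE -[leRHS]real_normK ?num_real// lerXn2r ?nnegrE ?(ltW yi)//.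
    by rewrite !mulr_ge0// ltW.
  by apply: sumr_ge0 => i' _; exact: sqr_ge0.
have tail := gaussian_mixture_tail s0 sigma0 w0 w1 pS dS qS mS tailS.
have LS := lebesgue_cover_le s0 (ltW A0) center.
have bw0 := bracket_width_ge0 d A s0 m T.
have bound := @bracketing_hellinger_bound _ _ _ (lebesgue_rV R d) hstar mh h_gt0 h1
  _ _ P n Y n0 indep dens S _ _ (2 * bracket_width d s A m T)
  (bracket_index d m T ('I_k * {ffun 'I_d -> 'I_L})%type)
  (@upper_bracket R d s A m T _ center) mS LS tail.
apply: le_trans (bound _ _ _ _ hhat mf f_gt0 f1 _ _) _.
- by rewrite mulr_ge0.
- by rewrite card_bracket_index expn_gt0.
- by move=> t; exact: measurable_upper_bracket.
- by move=> t y; exact: upper_bracket_ge0.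
- move=> omega; have [G fG] := fmix omega.
  have [t tE] := @mixture_bracketed R d s A s0 (ltW A0) m T _ center T0 G.
  by exists t => y Sy; rewrite fG tE.
- move=> omega; have [G hG] := hmix.
  under eq_bigr do rewrite hG.
  rewrite /hhat !big_split/=; apply: ler_wpM2l.
    by apply: prodr_ge0 => i _; rewrite invr_ge0 exprn_ge0// ltW.
  by apply: (npmle_likelihood n0 (npmle omega)); exists G.
rewrite lee_fin card_bracket_index card_prod card_ffun !card_ord.
exact: (total_rate_le n2 k1 s0 sigma0 t1_ge1 sigma_t1 small).
Qed.
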